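(* Let $T>0$, $0<\nu<1$, $g\in L_2([0,T])$, and let $K(t,s)=\dfrac{L(t,s)}{|t-s|^{\nu}}$ for $t,s\in[0,T]$, $t\neq s$, where $L:[0,T]^2\to\mathbb{R}$ satisfies: (i) $L$ is bounded and symmetric; (ii) $L$ is continuous on $[0,T]^2$ except at a finite number of points; (iii) $L$ is a positive definite kernel. Let $x\in L_2([0,T])$ be the unique solution of the equation $$x(t)+\int_0^T K(t,s)x(s)\,ds=g(t),\quad t\in[0,T].$$ Let $\delta\in(0,1/\nu)$. Then there exists a sequence of functions $L_n:[0,T]^2\to\mathbb{R}$, $n\ge1$, which is an admissible approximating sequence for $L$ with exponent parameter $\delta$ (as defined in the context), such that, putting $K_n(t,s)=\dfrac{L_n(t,s)}{|t-s|^{\nu}}$ and $(A_ny)(t)=\int_0^T K_n(t,s)y(s)\,ds$, the integral operators $A_n$ on $L_2([0,T])$ are self-adjoint, for all sufficiently large $n$ the equation $$x_n(t)+(A_nx_n)(t)=g(t),\quad t\in[0,T],$$ has a unique solution $x_n\in L_2([0,T])$, and $$\|x_n-x\|_{L_2([0,T])}\to0\quad\text{as } n\to\infty.$$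
   Context: $L_2([0,T])$ is the real Hilbert space of (classes of) square-integrable functions on $[0,T]$ with Lebesgue measure; equations between elements of $L_2([0,T])$ are understood almost everywhere. A symmetric function $L:[0,T]^2\to\mathbb{R}$ is a positive definite kernel if $\sum_{i,j=1}^m c_ic_jL(t_i,t_j)\ge0$ for all $m\ge1$, $t_1,\dots,t_m\in[0,T]$, $c_1,\dots,c_m\in\mathbb{R}$. Let $K(t,s)=L(t,s)|t-s|^{-\nu}$ and $K_n(t,s)=L_n(t,s)|t-s|^{-\nu}$. A sequence $(L_n)_{n\ge1}$ is called here an admissible approximating sequence for $L$ with exponent parameter $\delta\in(0,1/\nu)$ if: every $L_n$ is continuous on $[0,T]^2$; the $L_n$ are uniformly bounded, $|L_n(t,s)|\le M$ for all $n,t,s$, with the same constant $M$ as a bound $|L(t,s)|\le M$ for $L$; and there are constants $C_{1,n},C_{2,n}\to0$ as $n\to\infty$ such that $\int_0^T|K(t,s)-K_n(t,s)|^{\frac1\nu-\delta}dt<C_{1,n}$ for all $s\in[0,T]$ and $\int_0^T|K(t,s)-K_n(t,s)|^{\frac1\nu-\delta}ds<C_{2,n}$ for all $t\in[0,T]$. *)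

(* Defs.v *)
From HB Require Import structures.
From mathcomp Require Import all_boot all_order all_algebra.
From mathcomp Require Import all_classical all_reals all_analysis.

Set Implicit Arguments.
Unset Strict Implicit.
Unset Printing Implicit Defensive.
Import Order.TTheory GRing.Theory Num.Theory.
Import numFieldNormedType.Exports.
Local Open Scope classical_set_scope.
Local Open Scope ring_scope.

(* A function on [0, T] (or on [0, T]^2) is represented by a total function on
   R (or by a curried function R -> R -> R); every predicate below only looks
   at arguments in [0, T]. *)

Section defs.
Context {R : realType}.
Implicit Types (T nu delta M : R) (L K : R -> R -> R) (g x y z : R -> R).

Definition square T : set (R * R) := `[0, T] `*` `[0, T].

Definition lebesgue_on T : {measure set (measurableTypeR R) -> \bar R} :=
  mrestr (@lebesgue_measure R) (measurable_itv `[0, T]).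

(* Representatives of the elements of L_2([0, T]): these are Borel functions on
   R; two of them are the same element when they agree [lebesgue_on T]-almost
   everywhere, that is, almost everywhere on [0, T]. *)
Definition L2 T : {pred (R -> R)} := Lfun (lebesgue_on T) 2%:E.

Definition L2norm T y : \bar R := ('N[lebesgue_on T]_2%:E[EFin \o y])%E.

Definition L2dot T y z : R := \int[lebesgue_on T]_t (y t * z t).

Definition bounded_by T M L :=
  forall t s, t \in `[0, T] -> s \in `[0, T] -> `|L t s| <= M.

Definition symmetric_on T L :=
  forall t s, t \in `[0, T] -> s \in `[0, T] -> L t s = L s t.

Definition continuous_on_square T L :=
  {within square T, continuous (fun p => L p.1 p.2)}.

Definition continuous_except_finite T L :=
  exists2 S : set (R * R), finite_set S &
    {within square T `\` S, continuous (fun p => L p.1 p.2)}.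

Definition positive_definite T L :=
  forall (m : nat) (t c : 'I_m -> R), (1 <= m)%N ->
    (forall i, t i \in `[0, T]) ->
    0 <= \sum_(i < m) \sum_(j < m) c i * c j * L (t i) (t j).

(* On the diagonal the denominator is [0 `^ nu = 0] for [nu != 0], so that the
   value there is 0; the diagonal is irrelevant for all the integrals below. *)
Definition kernel_of nu L t s : R := L t s / `|t - s| `^ nu.

Definition kernel_integrable T K y t :=
  (@lebesgue_measure R).-integrable `[0, T] (fun s => (K t s * y s)%:E).

(* The value is set to 0 outside [0, T], so that the image does not depend on
   the values of [K] there. *)
Definition integral_op T K y : R -> R :=
  (fun t => \int[@lebesgue_measure R]_(s in `[0, T]) (K t s * y s)) \_ `[0, T].

Definition is_solution T K g x :=
  [/\ x \in L2 T,
      {ae lebesgue_on T, forall t, kernel_integrable T K x t} &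
      {ae lebesgue_on T, forall t, x t + integral_op T K x t = g t}].

Definition is_unique_solution T K g x :=
  is_solution T K g x /\
  (forall y, is_solution T K g y -> {ae lebesgue_on T, forall t, y t = x t}).

Definition bounded_linear_op T (A : (R -> R) -> (R -> R)) :=
  [/\ forall y, y \in L2 T -> A y \in L2 T,
      forall (a : R) y z, y \in L2 T -> z \in L2 T ->
        {ae lebesgue_on T, forall t,
           A (fun r => a * y r + z r) t = a * A y t + A z t} &
      exists c : R, forall y, y \in L2 T ->
        (L2norm T (A y) <= c%:E * L2norm T y)%E].

Definition self_adjoint_op T (A : (R -> R) -> (R -> R)) :=
  bounded_linear_op T A /\
  (forall y z, y \in L2 T -> z \in L2 T -> L2dot T (A y) z = L2dot T y (A z)).

Definition self_adjoint_integral_op T K :=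
  (forall y, y \in L2 T ->
     {ae lebesgue_on T, forall t, kernel_integrable T K y t}) /\
  self_adjoint_op T (integral_op T K).

Definition admissible_approximation T nu delta M L (L_ : nat -> R -> R -> R) :=
  [/\ forall n, continuous_on_square T (L_ n),
      bounded_by T M L,
      forall n, bounded_by T M (L_ n) &
      exists C1 C2 : nat -> R,
        [/\ C1 @ \oo --> (0 : R),
            C2 @ \oo --> (0 : R),
            forall n s, s \in `[0, T] ->
              (\int[@lebesgue_measure R]_(t in `[0%R, T])
                 (`|kernel_of nu L t s - kernel_of nu (L_ n) t s|
                    `^ (nu^-1 - delta))%:E < (C1 n)%:E)%E &
            forall n t, t \in `[0, T] ->
              (\int[@lebesgue_measure R]_(s in `[0%R, T])
                 (`|kernel_of nu L t s - kernel_of nu (L_ n) t s|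
                    `^ (nu^-1 - delta))%:E < (C2 n)%:E)%E]].

End defs.

(* Main.v *)
(** The kernel is cut off around the exceptional points: [L_n] is [L] times a
   continuous factor that vanishes at those points and equals 1 at distance at
   least [1 / n.+1] from them. As [|t - s| ^- nu] is integrable uniformly in [s],
   Schur's test gives [A_n -> A] in operator norm.

   [A] is positive: [1 - |t - s| / T] is a Schur multiplier on every grid (it
   counts the grid points that do not separate [t] from [s]), and hence so are
   the powers [(h + |t - s|) ^- nu] with [h] the mesh, obtained through geometric
   series, [- ln (1 - z)] and [expR]. Sampling [L] on the grid gives step kernels
   with a nonnegative quadratic form, which converge to that of [A] by dominated
   convergence.

   Therefore [I + A_n] is coercive with constant 1/2 for large [n]. Richardson
   iteration then solves the equation, and coercivity bounds [x_n - x] by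
   [2 * ||(A - A_n) x||]. *)
Require Import Defs.
From HB Require Import structures.
From mathcomp Require Import all_boot all_order all_algebra.
From mathcomp Require Import all_classical all_reals all_analysis.
From mathcomp Require Import measurable_realfun zify lra ring.
Set Implicit Arguments.
Unset Strict Implicit.
Unset Printing Implicit Defensive.
Import Order.TTheory GRing.Theory Num.Theory.
Import numFieldNormedType.Exports.
Local Open Scope classical_set_scope.
Local Open Scope ring_scope.

(** * Square-integrable functions *)

(** The cutoff factor need not be a positive definite kernel, so [A_n] itself may fail to be
    positive; coercivity of [I + A_n] is borrowed from [A] through the norm of [A - A_n], which is
    why solvability is claimed only for large [n]. For [nu >= 1/2] the kernel is in general not
    square integrable on the square, so Hilbert-Schmidt bounds are out of reach. Schur's test asks
    only for uniform bounds on the integrals in one variable. For these, exceptional points of the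
    plane are harmless: whatever [t] is, [L - L_n] vanishes unless [s] lies in one of a fixed number
    of intervals of radius [1 / n.+1], which gives the rate [n.+1 ^- (1 - nu)]. Positive
    definiteness speaks of finite samples, while [|t - s| ^- nu] blows up on the diagonal, so the
    product kernel cannot be sampled as it stands. Shifting the distance by the mesh makes the
    diagonal entries finite and, since sampling moves each point by less than the mesh, keeps the
    samples below the true singularity, as dominated convergence requires. *)

Section square_integrable.
Context d (X : measurableType d) (R : realType) (mu : {measure set X -> \bar R}).
Implicit Types f g h : X -> R.
Local Notation L2 := (Lfun mu 2%:E).

Lemma Lfun2P f : f \in L2 <->
  measurable_fun setT f /\ (\int[mu]_x (f x ^+ 2)%:E < +oo)%E.
Proof.
have N2E : (\int[mu]_x (f x ^+ 2)%:E = \int[mu]_x (`|(EFin \o f) x| `^ 2))%E.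
  by apply: eq_integral => x _ /=; rewrite powR_mulrn// real_normK ?num_real.
rewrite N2E; split=> [/andP[]|[mf lf]].
  rewrite !inE/= => mf; rewrite /finite_norm unlock => lf; split => //.
  exact: lty_poweRy lf.
apply/andP; split; rewrite inE//= /finite_norm unlock.
exact: poweR_lty.
Qed.

Lemma Lfun2_measurable f : f \in L2 -> measurable_fun setT f.
Proof. by case/Lfun2P. Qed.

Lemma Lfun2_mul_integrable f g : f \in L2 -> g \in L2 ->
  mu.-integrable setT (EFin \o (fun x => f x * g x)).
Proof. by move=> lf lg; apply/Lfun1_integrable; exact: Lfun2_mul_Lfun1. Qed.

Lemma Lfun2_comb (a b : R) f g : f \in L2 -> g \in L2 ->
  (fun x => a * f x + b * g x) \in L2.
Proof.
move=> lf lg; apply/Lfun2P; split.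
  apply: measurable_funD; apply: measurable_funM => //;
    exact: Lfun2_measurable.
have i2 : mu.-integrable setT (EFin \o (fun x => (2 * a ^+ 2) * (f x * f x)
    + (2 * b ^+ 2) * (g x * g x))).
  rewrite (_ : _ \o _ = fun x => (2 * a ^+ 2)%:E * (f x * f x)%:E
      + (2 * b ^+ 2)%:E * (g x * g x)%:E)%E//.
  by apply: integrableD => //; apply: integrableZl => //;
    exact: Lfun2_mul_integrable.
move/integrableP : i2 => [mi2]; apply: le_lt_trans.
apply: ge0_le_integral => //.
- by move=> x _; rewrite lee_fin sqr_ge0.
- apply/measurable_EFinP/measurable_funX/measurable_funD;
    apply: measurable_funM => //; exact: Lfun2_measurable.
- exact: measurableT_comp.
- move=> x _ /=; rewrite lee_fin; apply: le_trans (ler_norm _).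
  (* The gap between the two sides is exactly this square. *)
  rewrite -subr_ge0; apply: le_trans (sqr_ge0 (a * f x - b * g x)) _.
  by rewrite le_eqVlt; apply/orP; left; apply/eqP; ring.
Qed.

Lemma Lfun2_dom f g : measurable_fun setT f -> g \in L2 ->
  {ae mu, forall x, `|f x| <= `|g x|} -> f \in L2.
Proof.
move=> mf lg fg; apply/Lfun2P; split=> //.
move: (lg) => /Lfun2P[mg]; apply: le_lt_trans.
apply: ae_ge0_le_integral => //.
- by move=> x _; rewrite lee_fin sqr_ge0.
- exact/measurable_EFinP/measurable_funX.
- by move=> x _; rewrite lee_fin sqr_ge0.
- exact/measurable_EFinP/measurable_funX.
- apply: filterS fg => x fgx _.
  rewrite lee_fin -[leLHS]real_normK ?num_real// -[leRHS]real_normK ?num_real//.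
  by rewrite ler_pXn2r// nnegrE.
Qed.

Lemma Lfun2B f g : f \in L2 -> g \in L2 -> (fun x => f x - g x) \in L2.
Proof.
move=> lf lg; rewrite (_ : (fun _ => _) = fun x => 1 * f x + (-1) * g x).
  exact: Lfun2_comb.
by apply/funext => x; ring.
Qed.

Lemma Lfun2D f g : f \in L2 -> g \in L2 -> (fun x => f x + g x) \in L2.
Proof.
move=> lf lg; rewrite (_ : (fun _ => _) = fun x => 1 * f x + 1 * g x).
  exact: Lfun2_comb.
by apply/funext => x; ring.
Qed.

Lemma Lfun2Z (a : R) f : f \in L2 -> (fun x => a * f x) \in L2.
Proof.
move=> lf; rewrite (_ : (fun _ => _) = fun x => a * f x + 0 * f x).
  exact: Lfun2_comb.
by apply/funext => x; ring.
Qed.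

Definition dot f g : R := \int[mu]_x (f x * g x).

Lemma dotE f g : f \in L2 -> g \in L2 ->
  (dot f g)%:E = (\int[mu]_x (f x * g x)%:E)%E.
Proof.
move=> lf lg; rewrite /dot /Rintegral fineK//.
exact: integrable_fin_num (Lfun2_mul_integrable lf lg).
Qed.

Lemma dotC f g : dot f g = dot g f.
Proof. by apply: eq_Rintegral => x _; rewrite mulrC. Qed.

Lemma dot_ge0 f : 0 <= dot f f.
Proof. by apply: Rintegral_ge0 => x _; rewrite -expr2 sqr_ge0. Qed.

Lemma dot_combl (a b : R) f g h : f \in L2 -> g \in L2 -> h \in L2 ->
  dot (fun x => a * f x + b * g x) h = a * dot f h + b * dot g h.
Proof.
move=> lf lg lh; rewrite /dot -!RintegralZl//; try exact: Lfun2_mul_integrable.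
rewrite -RintegralD//.
- by apply: eq_Rintegral => x _; ring.
- exact: (integrableZl measurableT a (Lfun2_mul_integrable lf lh)).
- exact: (integrableZl measurableT b (Lfun2_mul_integrable lg lh)).
Qed.

Lemma dotBl f g h : f \in L2 -> g \in L2 -> h \in L2 ->
  dot (fun x => f x - g x) h = dot f h - dot g h.
Proof.
move=> lf lg lh; rewrite (_ : (fun _ => _) = fun x => 1 * f x + (-1) * g x).
  by rewrite dot_combl//; ring.
by apply/funext => x; ring.
Qed.

Lemma dotDl f g h : f \in L2 -> g \in L2 -> h \in L2 ->
  dot (fun x => f x + g x) h = dot f h + dot g h.
Proof.
move=> lf lg lh; rewrite (_ : (fun _ => _) = fun x => 1 * f x + 1 * g x).
  by rewrite dot_combl//; ring.
by apply/funext => x; ring.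
Qed.

Lemma dotZl (a : R) f h : f \in L2 -> h \in L2 ->
  dot (fun x => a * f x) h = a * dot f h.
Proof.
move=> lf lh; rewrite (_ : (fun _ => _) = fun x => a * f x + 0 * f x).
  by rewrite dot_combl//; ring.
by apply/funext => x; ring.
Qed.

Lemma dot_ae f f' g g' : f \in L2 -> f' \in L2 -> g \in L2 -> g' \in L2 ->
  {ae mu, forall x, f x = f' x} -> {ae mu, forall x, g x = g' x} ->
  dot f g = dot f' g'.
Proof.
move=> lf lf' lg lg' ff' gg'; rewrite /dot /Rintegral; congr fine.
apply: ae_eq_integral => //;
  try (apply/measurable_EFinP/measurable_funM; exact: Lfun2_measurable).
by apply: filterS2 ff' gg' => x -> ->.
Qed.

Lemma ler_dot f g : f \in L2 -> g \in L2 ->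
  {ae mu, forall x, `|f x| <= `|g x|} -> dot f f <= dot g g.
Proof.
move=> lf lg fg; rewrite -lee_fin !dotE//; apply: ae_ge0_le_integral => //.
- by move=> x _; rewrite lee_fin -expr2 sqr_ge0.
- by apply/measurable_EFinP/measurable_funM; exact: Lfun2_measurable.
- by move=> x _; rewrite lee_fin -expr2 sqr_ge0.
- by apply/measurable_EFinP/measurable_funM; exact: Lfun2_measurable.
- apply: filterS fg => x fgx _; rewrite lee_fin -!expr2.
  rewrite -[leLHS]real_normK ?num_real// -[leRHS]real_normK ?num_real//.
  by rewrite ler_pXn2r// nnegrE.
Qed.

Lemma dot_eq0 f : f \in L2 -> dot f f = 0 -> {ae mu, forall x, f x = 0}.
Proof.
move=> lf f0; have mf := Lfun2_measurable lf.
have mff : measurable_fun setT (EFin \o (fun x => f x * f x)).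
  exact/measurable_EFinP/measurable_funM.
have /(ae_eq_integral_abs mu measurableT mff) :
    (\int[mu]_x `|(EFin \o (fun x => f x * f x)%R) x| = 0)%E.
  transitivity ((dot f f)%:E); last by rewrite f0.
  rewrite dotE//; apply: eq_integral => x _.
  by rewrite gee0_abs// lee_fin -expr2 sqr_ge0.
by apply: filterS => x /(_ I) [] /eqP; rewrite mulf_eq0 orbb => /eqP.
Qed.

Lemma cauchy_schwarz f g : f \in L2 -> g \in L2 ->
  dot f g ^+ 2 <= dot f f * dot g g.
Proof.
move=> lf lg.
have key (a b : R) : 0 <= a ^+ 2 * dot f f + 2 * a * b * dot f g
    + b ^+ 2 * dot g g.
  have := dot_ge0 (fun x => a * f x + b * g x).
  rewrite dot_combl//; last exact: Lfun2_comb.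
  rewrite dotC (dotC g) !dot_combl//= (dotC g f).
  by move=> /le_trans; apply; rewrite le_eqVlt; apply/orP; left; apply/eqP; ring.
have [g0|g0] := eqVneq (dot g g) 0.
  (* Here the form takes the value [- (2 + dot f f) * dot f g ^+ 2], so its nonnegativity forces
     [dot f g = 0]. *)
  rewrite g0 mulr0; have /= := key (dot f g) (- (1 + dot f f)).
  rewrite g0; have := dot_ge0 f; have := sqr_ge0 (dot f g); nra.
have gp : 0 < dot g g by rewrite lt_def g0 dot_ge0.
have := key (dot g g) (- dot f g).
rewrite (_ : _ + _ = dot g g * (dot f f * dot g g - dot f g ^+ 2)); last by ring.
by rewrite pmulr_rge0// subr_ge0.
Qed.

Lemma ler_dot_sqrt f g : f \in L2 -> g \in L2 ->
  `|dot f g| <= Num.sqrt (dot f f) * Num.sqrt (dot g g).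
Proof.
move=> lf lg; rewrite -sqrtrM ?dot_ge0// -sqrtr_sqr.
by apply: ler_wsqrtr; exact: cauchy_schwarz.
Qed.

Lemma Lnorm2E f : f \in L2 ->
  ('N[mu]_2%:E[EFin \o f])%E = (Num.sqrt (dot f f))%:E.
Proof.
move=> lf; rewrite unlock /=.
rewrite (_ : (\int[mu]_x _)%E = (dot f f)%:E).
  by rewrite poweR_EFin powR12_sqrt// dot_ge0.
rewrite dotE//; apply: eq_integral => x _ /=.
by rewrite -expr2 powR_mulrn// real_normK ?num_real.
Qed.

End square_integrable.

(** * Schur's test *)

Section schur_test.
Context d (X : measurableType d) (R : realType)
  (mu : {finite_measure set X -> \bar R}).
Implicit Types (y z : X -> R) (t s : X).
Local Notation L2 := (Lfun mu 2%:E).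
Variables (k : X * X -> R) (C : R).
Hypothesis mk : measurable_fun setT k.
Hypothesis k_sym : forall t s, k (t, s) = k (s, t).
Hypothesis C_ge0 : 0 <= C.
Hypothesis kC : forall t, (\int[mu]_s `|k (t, s)|%:E <= C%:E)%E.

Definition kernel_op y t : R := \int[mu]_s (k (t, s) * y s).

Let mk1 t : measurable_fun setT (fun s => k (t, s)).
Proof. exact: measurable_fun_pair2. Qed.

(** Extended values are essential: that [F y t] is finite for almost every [t] is a consequence of
    [int_F_sqr], not known beforehand. *)
Let F y t := (\int[mu]_s `|k (t, s) * y s|%:E)%E.
Let G y t := (\int[mu]_s (`|k (t, s)| * y s ^+ 2)%:E)%E.

Let F_ge0 y t : (0 <= F y t)%E.
Proof. by apply: integral_ge0 => s _; rewrite lee_fin. Qed.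

Let measurable_prod y z : measurable_fun setT y -> measurable_fun setT z ->
  measurable_fun setT (fun p : X * X => k p * y p.2 * z p.1).
Proof.
move=> my mz; apply: measurable_funM; first apply: measurable_funM => //.
  exact: measurableT_comp.
exact: measurableT_comp.
Qed.

Let measurable_F y : measurable_fun setT y -> measurable_fun setT (F y).
Proof.
move=> my.
apply: (@measurable_fun_fubini_tonelli_F _ _ _ _ _ mu
  (fun p : X * X => `|k p * y p.2|%:E)).
  apply/measurable_EFinP/measurableT_comp => //.
  by apply: measurable_funM => //; exact: measurableT_comp.
by move=> p; rewrite lee_fin.
Qed.

(** Cauchy-Schwarz for the splitting of [|k|] into two factors [sqrt |k|]: one factor alone
    integrates to at most [C], the other carries [y]. *)
Let F_sqr y t : measurable_fun setT y -> (F y t * F y t <= C%:E * G y t)%E.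
Proof.
move=> my.
have mf : measurable_fun setT (fun s => Num.sqrt `|k (t, s)|).
  apply: (measurableT_comp (continuous_measurable_fun (@sqrt_continuous R))).
  exact: measurableT_comp.
have mg : measurable_fun setT (fun s => Num.sqrt `|k (t, s)| * y s).
  exact: measurable_funM.
have := hoelder mu mf mg (ltr0n _ 2) (ltr0n _ 2).
have -> : 2%:R^-1 + 2%:R^-1 = 1 :> R by lra.
move=> /(_ erefl).
rewrite Lnorm1.
rewrite (_ : (\int[mu]_x _)%E = F y t); last first.
  apply: eq_integral => s _ /=; rewrite mulrA -expr2 sqr_sqrtr//.
  by rewrite !normrM normr_id.
have sA : (('N[mu]_2%:E[EFin \o (fun s => Num.sqrt `|k (t, s)|)] *
           'N[mu]_2%:E[EFin \o (fun s => Num.sqrt `|k (t, s)| * y s)%R]) ^+ 2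
   <= C%:E * G y t)%E.
  have sE f : ('N[mu]_2%:E[EFin \o f] * 'N[mu]_2%:E[EFin \o f]
      = \int[mu]_s (f s ^+ 2)%:E)%E.
    rewrite unlock poweR12_sqrt; last first.
      by apply: integral_ge0 => s _; rewrite poweR_ge0.
    rewrite -expe2 sqr_sqrte; last first.
      by apply: integral_ge0 => s _; rewrite poweR_ge0.
    apply: eq_integral => s _ /=.
    by rewrite powR_mulrn// real_normK ?num_real.
  rewrite expe2 muleACA !sE; apply: lee_pmul.
  - by apply: integral_ge0 => s _; rewrite lee_fin sqr_ge0.
  - by apply: integral_ge0 => s _; rewrite lee_fin sqr_ge0.
  - under eq_integral do rewrite sqr_sqrtr//.
    exact: kC.
  - by under eq_integral do rewrite exprMn sqr_sqrtr//.
move=> FN; apply: le_trans sA; rewrite expe2.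
by apply: lee_pmul.
Qed.

(** After Tonelli the inner integral runs over the first variable of [k]; symmetry lets the row
    bound [kC] serve for columns too. *)
Let int_G y : measurable_fun setT y ->
  (\int[mu]_t G y t <= C%:E * \int[mu]_s (y s ^+ 2)%:E)%E.
Proof.
move=> my.
have mh : measurable_fun setT (fun p : X * X => (`|k p| * y p.2 ^+ 2)%:E).
  apply/measurable_EFinP/measurable_funM; first exact: measurableT_comp.
  by apply: measurable_funX; exact: measurableT_comp.
have h0 p : (0 <= (`|k p| * y p.2 ^+ 2)%:E)%E.
  by rewrite lee_fin mulr_ge0// sqr_ge0.
rewrite /G (fubini_tonelli (fun p : X * X => (`|k p| * y p.2 ^+ 2)%:E))//.
rewrite -ge0_integralZl//; last 2 first.
- exact/measurable_EFinP/measurable_funX.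
- by move=> s _; rewrite lee_fin sqr_ge0.
apply: ge0_le_integral => //.
- by move=> s _; exact: integral_ge0.
- exact: (@measurable_fun_fubini_tonelli_G _ _ _ _ _ mu
    (fun p : X * X => (`|k p| * y p.2 ^+ 2)%:E)).
- by apply: emeasurable_funM => //; exact/measurable_EFinP/measurable_funX.
move=> s _ /=; under eq_integral do rewrite EFinM.
rewrite ge0_integralZr//.
- apply: lee_pmul => //.
  + by apply: integral_ge0 => t _; rewrite lee_fin.
  + by rewrite lee_fin sqr_ge0.
  + by under eq_integral do rewrite k_sym; exact: kC.
- apply/measurable_EFinP/measurableT_comp => //.
  exact: measurable_fun_pair1.
- by rewrite lee_fin sqr_ge0.
Qed.

Let int_F_sqr y : measurable_fun setT y ->
  (\int[mu]_t (F y t * F y t) <= (C ^+ 2)%:E * \int[mu]_s (y s ^+ 2)%:E)%E.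
Proof.
move=> my; have mG : measurable_fun setT (G y).
  apply: (@measurable_fun_fubini_tonelli_F _ _ _ _ _ mu
    (fun p : X * X => (`|k p| * y p.2 ^+ 2)%:E)).
    apply/measurable_EFinP/measurable_funM; first exact: measurableT_comp.
    by apply: measurable_funX; exact: measurableT_comp.
  by move=> p; rewrite lee_fin mulr_ge0// sqr_ge0.
have G0 t : (0 <= G y t)%E.
  by apply: integral_ge0 => s _; rewrite lee_fin mulr_ge0// sqr_ge0.
apply: (@le_trans _ _ (\int[mu]_t (C%:E * G y t))%E).
  apply: ge0_le_integral => //.
  - by move=> t _; exact: mule_ge0.
  - by apply: emeasurable_funM; exact: measurable_F.
  - exact: emeasurable_funM.
  - by move=> t _; exact: F_sqr.
rewrite ge0_integralZl// expr2 EFinM -muleA lee_wpmul2l//.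
exact: int_G.
Qed.

Lemma kernel_op_ae_integrable y : y \in L2 ->
  {ae mu, forall t, mu.-integrable setT (fun s => (k (t, s) * y s)%:E)}.
Proof.
move=> ly; have /Lfun2P[my y2] := ly.
have FF : mu.-integrable setT (fun t => (F y t * F y t)%E).
  apply/integrableP; split.
    by apply: emeasurable_funM; exact: measurable_F.
  under eq_integral do rewrite gee0_abs ?mule_ge0//.
  by apply: le_lt_trans (int_F_sqr my) _; rewrite lte_mul_pinfty// lee_fin sqr_ge0.
have := integrable_ae measurableT FF; apply: filterS => t /(_ I) Ft.
apply/integrableP; split; first exact/measurable_EFinP/measurable_funM.
change (F y t < +oo)%E; rewrite ltey; apply/negP => /eqP Fy.
by move: Ft; rewrite Fy.
Qed.

(** The inner integral of the absolute value is [F y t * |z t|], at most [F y t ^ 2 + z t ^ 2]. This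
    is what licenses Fubini in the duality statements below. *)
Lemma kernel_op_prod_integrable y z : y \in L2 -> z \in L2 ->
  (mu \x mu)%E.-integrable setT
    (fun p : X * X => (k p * y p.2 * z p.1)%:E).
Proof.
move=> ly lz; have /Lfun2P[my y2] := ly; have /Lfun2P[mz z2] := lz.
have mP : measurable_fun setT (fun p : X * X => (k p * y p.2 * z p.1)%:E).
  by apply/measurable_EFinP; exact: measurable_prod.
apply: (@integrable12ltyP _ _ _ _ _ mu mu _ mP).2.
apply: (@le_lt_trans _ _ (\int[mu]_t (F y t * F y t + (z t ^+ 2)%:E)))%E.
  apply: ge0_le_integral => //.
  - move=> t _; exact: integral_ge0.
  - apply: (@measurable_fun_fubini_tonelli_F _ _ _ _ _ mu
      (fun p : X * X => `|(k p * y p.2 * z p.1)%:E|%E)) => //.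
    exact: measurableT_comp.
  - apply: emeasurable_funD; first by apply: emeasurable_funM; exact: measurable_F.
    exact/measurable_EFinP/measurable_funX.
  move=> t _ /=; under eq_integral do rewrite normrM EFinM.
  rewrite ge0_integralZr//; last first.
    by apply/measurable_EFinP/measurableT_comp => //; exact: measurable_funM.
  rewrite -/(F y t); have := F_ge0 y t.
  case: (F y t) => [r|_|//].
    rewrite lee_fin => r0; rewrite -!EFinM -EFinD lee_fin.
    rewrite -[in leRHS](real_normK (num_real (z t))).
    by have := sqr_ge0 (r - `|z t|); have := normr_ge0 (z t); nra.
  by rewrite [X in (_ <= X + _)%E]gt0_mulye// addye// leey.
rewrite ge0_integralD//.
- rewrite lte_add_pinfty//.
  by apply: le_lt_trans (int_F_sqr my) _; rewrite lte_mul_pinfty// lee_fin sqr_ge0.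
- by move=> t _; exact: mule_ge0.
- by apply: emeasurable_funM; exact: measurable_F.
- by move=> t _; rewrite lee_fin sqr_ge0.
- exact/measurable_EFinP/measurable_funX.
Qed.

(** Fubini against the test function 1, which is square integrable because [mu] is finite. *)
Lemma measurable_kernel_op y : y \in L2 -> measurable_fun setT (kernel_op y).
Proof.
move=> ly; have l1 : cst 1 \in L2 by exact: Lfun_cst.
apply: (measurableT_comp (@fine_measurable R setT measurableT)) => //.
have := @measurable_fubini_F _ _ _ _ _ mu mu _ (kernel_op_prod_integrable ly l1).
rewrite /fubini_F /=.
by under eq_fun do under eq_integral do rewrite mulr1.
Qed.

Lemma kernel_op_Lfun2 y : y \in L2 -> kernel_op y \in L2 /\
  dot mu (kernel_op y) (kernel_op y) <= C ^+ 2 * dot mu y y.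
Proof.
move=> ly; have /Lfun2P[my y2] := ly.
have mA := measurable_kernel_op ly.
have le2 : (\int[mu]_t (kernel_op y t ^+ 2)%:E
    <= (C ^+ 2)%:E * \int[mu]_s (y s ^+ 2)%:E)%E.
  apply: le_trans (int_F_sqr my).
  apply: ae_ge0_le_integral => //.
  - by move=> t _; rewrite lee_fin sqr_ge0.
  - exact/measurable_EFinP/measurable_funX.
  - by move=> t _; exact: mule_ge0.
  - by apply: emeasurable_funM; exact: measurable_F.
  apply: filterS (kernel_op_ae_integrable ly) => t it _.
  have : (`|(kernel_op y t)%:E| <= F y t)%E.
    rewrite /= EFin_normr_Rintegral//; exact: le_abse_integral (measurable_int _ it).
  rewrite /= => AF; rewrite -real_normK ?num_real// expr2 EFinM.
  exact: lee_pmul.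
have lA : kernel_op y \in L2.
  apply/Lfun2P; split => //; apply: le_lt_trans le2 _.
  by rewrite lte_mul_pinfty// lee_fin sqr_ge0.
split => //; rewrite -lee_fin EFinM !dotE//.
Qed.

Lemma kernel_op_dotE y z : y \in L2 -> z \in L2 ->
  ((dot mu (kernel_op y) z)%:E =
    \int[mu \x mu]_p (k p * y p.2 * z p.1)%:E)%E.
Proof.
move=> ly lz; have [lA _] := kernel_op_Lfun2 ly.
have iP := kernel_op_prod_integrable ly lz.
rewrite -(@integral12_prod_meas1 _ _ _ _ _ mu mu _ iP) dotE//.
apply: ae_eq_integral => //.
- apply/measurable_EFinP/measurable_funM; [exact: Lfun2_measurable lA|exact: Lfun2_measurable lz].
- exact: (@measurable_fubini_F _ _ _ _ _ mu mu _ iP).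
apply: filterS (kernel_op_ae_integrable ly) => t it _.
rewrite /fubini_F /=; under eq_integral do rewrite EFinM.
rewrite integralZr// EFinM; congr (_ * _)%E.
by rewrite /kernel_op /Rintegral fineK//; exact: integrable_fin_num.
Qed.

Lemma kernel_op_sym y z : y \in L2 -> z \in L2 ->
  dot mu (kernel_op y) z = dot mu y (kernel_op z).
Proof.
move=> ly lz; apply: EFin_inj; rewrite [in RHS]dotC !kernel_op_dotE//.
rewrite -[RHS](@integral12_prod_meas1 _ _ _ _ _ mu mu _ (kernel_op_prod_integrable lz ly)).
rewrite -(@integral21_prod_meas1 _ _ _ _ _ mu mu _ (kernel_op_prod_integrable ly lz)).
apply: eq_integral => t _; apply: eq_integral => s _ /=.
by rewrite k_sym; congr EFin; ring.
Qed.

(** Linearity can be stated only almost everywhere: where a row times [y] or [z] is not integrable,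
    the real integral has a conventional value. *)
Lemma kernel_op_comb (a b : R) y z : y \in L2 -> z \in L2 ->
  {ae mu, forall t, kernel_op (fun r => a * y r + b * z r) t
    = a * kernel_op y t + b * kernel_op z t}.
Proof.
move=> ly lz; apply: filterS2 (kernel_op_ae_integrable ly)
  (kernel_op_ae_integrable lz) => t iy iz.
rewrite /kernel_op -!RintegralZl// -RintegralD//.
- by apply: eq_Rintegral => s _; ring.
- exact: (integrableZl measurableT a iy).
- exact: (integrableZl measurableT b iz).
Qed.

End schur_test.

(** * Coercive equations *)

Lemma geometric_tail (R : realType) (u : nat -> R) (a p : R) : 0 <= p < 1 ->
  (forall k, `|u k| <= a * p ^+ k) ->
  cvgn (series u) /\
  forall n, `|limn (series u) - series u n| <= a * p ^+ n / (1 - p).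
Proof.
move=> /andP[p0 p1] ua.
have a0 : 0 <= a by have := ua 0%N; rewrite expr0 mulr1; apply: le_trans.
have cu : cvgn (series u).
  apply: normed_cvg.
  apply: (@series_le_cvg _ _ (geometric a p)) => [n|n|n|] /=.
  - exact: normr_ge0.
  - by rewrite mulr_ge0// exprn_ge0.
  - exact: ua.
  - by apply: is_cvg_geometric_series; rewrite ger0_norm.
split=> // n.
(* The exact geometric factor [1 - p ^+ m] is what makes the induction on [m] close. *)
have step m : `|series u (m + n)%N - series u n|
    <= a * p ^+ n / (1 - p) * (1 - p ^+ m).
  elim: m => [|m IHm]; first by rewrite add0n subrr normr0 expr0 subrr mulr0.
  rewrite addSn /series/= big_nat_recr//=.
  rewrite addrAC; apply: le_trans (ler_normD _ _) _.
  apply: le_trans (lerD IHm (ua _)) _.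
  rewrite le_eqVlt; apply/orP; left; apply/eqP.
  have : 1 - p != 0 by rewrite gt_eqF// subr_gt0.
  by rewrite exprD exprS => ?; field.
have cm : `|series u (m + n)%N - series u n| @[m --> \oo]
    --> `|limn (series u) - series u n|.
  apply: cvg_norm; apply: cvgB; last exact: cvg_cst.
  by rewrite (cvg_shiftn n (series u)).
rewrite -(cvg_lim _ cm)//; apply: limr_le; first by apply/cvg_ex; exists (`|limn (series u) - series u n|).
apply: nearW => m; apply: le_trans (step m) _.
rewrite ler_piMr//.
  by rewrite divr_ge0 ?mulr_ge0 ?exprn_ge0// subr_ge0 ltW.
by rewrite gerBl exprn_ge0.
Qed.

Lemma nneseries_geometric (R : realType) (a p : R) : 0 <= p < 1 ->
  (\sum_(0 <= k <oo) (a * p ^+ k)%:E = (a / (1 - p))%:E)%E.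
Proof.
move=> /andP[p0 p1]; apply/cvg_lim => //.
rewrite (_ : (fun n => _) = EFin \o series (geometric a p)).
  apply: cvg_EFin; first exact: nearW.
  by apply: cvg_geometric_series; rewrite ger0_norm.
by apply/funext => n /=; rewrite sumEFin.
Qed.

Section L2_series.
Context d (X : measurableType d) (R : realType) (mu : {measure set X -> \bar R}).
Implicit Types (f g y z : X -> R).
Local Notation L2 := (Lfun mu 2%:E).

Lemma ler_dotD f g : f \in L2 -> g \in L2 ->
  dot mu (fun x => f x + g x) (fun x => f x + g x)
    <= 2 * dot mu f f + 2 * dot mu g g.
Proof.
move=> lf lg; have := dot_ge0 mu (fun x => f x - g x).
have lD := Lfun2D lf lg; have lB := Lfun2B lf lg.
rewrite (dotBl lf lg lB) (dotDl lf lg lD) (dotC _ f) (dotC _ g).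
rewrite (dotC _ f (fun _ => _ + _)) (dotC _ g (fun _ => _ + _)).
rewrite !dotBl// !dotDl// (dotC mu g f); lra.
Qed.

Lemma Lfun2_series (u : nat -> X -> R) n : (forall k, u k \in L2) ->
  (fun t => series (u ^~ t) n) \in L2.
Proof.
move=> lu; elim: n => [|n IHn].
  rewrite (_ : (fun _ => _) = fun t => 0 * u 0%N t); first exact: Lfun2Z.
  by apply/funext => t; rewrite /series/= big_geq// mul0r.
rewrite (_ : (fun _ => _) = fun t => series (u ^~ t) n + u n t).
  exact: Lfun2D.
by apply/funext => t; rewrite /series/= big_nat_recr.
Qed.

(* The weights [p ^- (2 k)] in [W] make the pointwise bound
   [`|u k x| <= p ^+ k * Num.sqrt (W x)] summable, while [W] is still
   integrable. *)
Lemma Lfun2_geometric_series (u : nat -> X -> R) (D p : R) : 0 < p < 1 ->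
  (forall k, u k \in L2) ->
  (forall k, dot mu (u k) (u k) <= D * p ^+ (4 * k)) ->
  exists2 x, x \in L2 & exists E, forall n,
    (fun t => x t - series (u ^~ t) n) \in L2 /\
    dot mu (fun t => x t - series (u ^~ t) n)
      (fun t => x t - series (u ^~ t) n) <= E * p ^+ (2 * n).
Proof.
move=> /andP[p0 p1] lu uD.
have mu_ k : measurable_fun setT (u k) := Lfun2_measurable (lu k).
pose w k t := p ^- (2 * k) * u k t ^+ 2.
have w0 k t : 0 <= w k t by rewrite mulr_ge0 ?sqr_ge0// invr_ge0 exprn_ge0// ltW.
pose W t := (\sum_(0 <= k <oo) (w k t)%:E)%E.
have mw k : measurable_fun setT (fun t => (w k t)%:E).
  apply/measurable_EFinP; apply: measurable_funM => //; exact: measurable_funX.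
have mW : measurable_fun setT W.
  by apply: ge0_emeasurable_sum => // k t _ _; rewrite lee_fin.
have W0 t : (0 <= W t)%E by apply: nneseries_ge0 => k _ _; rewrite lee_fin.
have p2 : 0 <= p ^+ 2 < 1 by rewrite exprn_ge0 ?ltW//= exprn_ilt1// ltW.
have iW : (\int[mu]_t W t <= (D / (1 - p ^+ 2))%:E)%E.
  rewrite integral_nneseries//; last by move=> n t _; rewrite lee_fin.
  rewrite -nneseries_geometric//; apply: lee_nneseries => [k _ _|k _].
    by apply: integral_ge0 => t _; rewrite lee_fin.
  rewrite /w; under eq_integral do rewrite EFinM expr2.
  rewrite ge0_integralZl//; last 3 first.
  - exact/measurable_EFinP/measurable_funM.
  - by move=> t _; rewrite lee_fin -expr2 sqr_ge0.
  - by rewrite lee_fin invr_ge0 exprn_ge0// ltW.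
  rewrite -dotE// -EFinM lee_fin -exprM mulrC ler_pdivrMr ?exprn_gt0//.
  by rewrite -mulrA -exprD -mulnDl.
pose w' t := fine (W t).
have mw' : measurable_fun setT w'.
  exact: (measurableT_comp (@fine_measurable R setT measurableT)).
have aeW : {ae mu, forall t, W t \is a fin_num}.
  have : mu.-integrable setT W.
    apply/integrableP; split => //; under eq_integral do rewrite gee0_abs//.
    exact: le_lt_trans iW (ltry _).
  by move/(integrable_ae measurableT); apply: filterS => t; apply.
have ub t : W t \is a fin_num -> forall k, `|u k t| <= Num.sqrt (w' t) * p ^+ k.
  move=> Wt k; have : ((w k t)%:E <= W t)%E.
    apply: le_trans (nneseries_lim_ge k.+1 _) => [|n _ _]; last by rewrite lee_fin.
    rewrite big_nat_recr//= leeDr// sume_ge0// => n _; by rewrite lee_fin.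
  rewrite -(fineK Wt) lee_fin -/(w' t) /w mulrC ler_pdivrMr ?exprn_gt0// => uw.
  rewrite -(ger0_norm (exprn_ge0 k (ltW p0))) -!sqrtr_sqr -sqrtrM ?fine_ge0//.
  by apply: ler_wsqrtr; rewrite -exprM mulnC.
(* Zeroing the terms where [W] is infinite makes the series converge at every point, so the limit is
   measurable; almost everywhere nothing changes. *)
pose E := setT `&` [set t | W t \is a fin_num].
have mE : measurable E by exact: emeasurable_fin_num.
pose v k := (u k) \_ E.
have vb t k : `|v k t| <= Num.sqrt (w' t) * p ^+ k.
  rewrite /v patchE; case: ifPn => [|_].
    by rewrite inE => -[_ /=] /ub; apply.
  by rewrite normr0 mulr_ge0// exprn_ge0// ltW.
have p01 : 0 <= p < 1 by rewrite ltW.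
pose x t := limn (series (v ^~ t)).
have mx : measurable_fun setT x.
  apply: (@measurable_fun_cvg _ _ _ _ (fun n t => series (v ^~ t) n)).
    move=> n; apply: measurable_sum => k.
    by apply/(measurable_restrict (u k) mE measurableT); exact: measurable_funTS.
  by move=> t _; exact: (geometric_tail p01 (vb t)).1.
have lw : (fun t => Num.sqrt (w' t)) \in L2.
  apply/Lfun2P; split.
    exact: (measurableT_comp (continuous_measurable_fun (@sqrt_continuous R))).
  apply: (@le_lt_trans _ _ (\int[mu]_t W t)%E); last first.
    exact: le_lt_trans iW (ltry _).
  apply: ge0_le_integral => //.
  - apply/measurable_EFinP/measurable_funX.
    exact: (measurableT_comp (continuous_measurable_fun (@sqrt_continuous R))).
  - move=> t _; rewrite sqr_sqrtr ?fine_ge0// /w'.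
    by have := W0 t; case: (W t) => //= r _; rewrite leey.
have lS n := Lfun2_series n lu.
have xS n : {ae mu, forall t, `|x t - series (u ^~ t) n|
    <= `|p ^+ n / (1 - p) * Num.sqrt (w' t)|}.
  apply: filterS aeW => t Wt.
  have vu : series (v ^~ t) = series (u ^~ t).
    apply/funext => m; rewrite /series/=; apply: eq_bigr => i _.
    by rewrite /v patchE ifT// inE.
  rewrite -vu; apply: le_trans ((geometric_tail p01 (vb t)).2 n) _.
  by apply: le_trans (ler_norm _); rewrite [leRHS]mulrC mulrA.
have lg n := Lfun2Z (p ^+ n / (1 - p)) lw.
have ld n : (fun t => x t - series (u ^~ t) n) \in L2.
  apply: (Lfun2_dom _ (lg n) (xS n)).
  by apply: measurable_funB => //; exact: Lfun2_measurable (lS n).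
exists x.
  by have := ld 0%N; under eq_fun do rewrite /series/= big_geq// subr0.
exists ((1 - p) ^- 2 * dot mu (fun t => Num.sqrt (w' t)) (fun t => Num.sqrt (w' t))).
move=> n; split => //; apply: le_trans (ler_dot (ld n) (lg n) (xS n)) _.
rewrite dotZl// dotC dotZl// le_eqVlt; apply/orP; left; apply/eqP.
by rewrite mulnC exprM; have : 1 - p != 0 by [rewrite gt_eqF// subr_gt0]; move=> ?; field.
Qed.

(* Richardson iteration: [y |-> y - tau * (y + A y)] is a contraction of L2 for
   a small step [tau]; its iterates are summed by [Lfun2_geometric_series]. *)
Lemma coercive_solvable (A : (X -> R) -> (X -> R)) (c C : R) g :
  (forall y, y \in L2 -> A y \in L2) ->
  (forall (a b : R) y z, y \in L2 -> z \in L2 ->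
    {ae mu, forall t, A (fun r => a * y r + b * z r) t = a * A y t + b * A z t}) ->
  (forall y, y \in L2 -> dot mu (A y) (A y) <= C ^+ 2 * dot mu y y) ->
  0 < c ->
  (forall y, y \in L2 -> c * dot mu y y <= dot mu y y + dot mu (A y) y) ->
  g \in L2 ->
  exists2 x, x \in L2 & {ae mu, forall t, x t + A x t = g t}.
Proof.
move=> hA hlin hC c0 hc lg.
pose B (y : X -> R) t := y t + A y t.
have lB y : y \in L2 -> B y \in L2 by move=> ly; exact: Lfun2D (hA _ ly).
(* [2 + 2 * C ^+ 2] bounds the squared norm of [B]; the surplus [c ^+ 2] guarantees
   [c ^+ 2 / K < 1], hence [rho > 0]. *)
pose K := 2 + 2 * C ^+ 2 + c ^+ 2.
have K0 : 0 < K by rewrite /K; have := sqr_ge0 C; have := sqr_ge0 c; lra.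
have BK y : y \in L2 -> dot mu (B y) (B y) <= K * dot mu y y.
  move=> ly; apply: le_trans (ler_dotD ly (hA _ ly)) _.
  have := hC _ ly; have := mulr_ge0 (sqr_ge0 c) (dot_ge0 mu y).
  by rewrite /K; lra.
have Bc y : y \in L2 -> c * dot mu y y <= dot mu (B y) y.
  by move=> ly; rewrite dotDl//; [exact: hc|exact: hA].
(* The minimiser of [1 - 2 * tau * c + tau ^+ 2 * K], the bound on the squared norm of [I - tau B];
   the minimum is [rho]. *)
pose tau := c / K.
have tau0 : tau != 0 by rewrite /tau mulf_neq0 ?invr_neq0// gt_eqF.
pose rho := 1 - c ^+ 2 / K.
have rho0 : 0 < rho.
  rewrite /rho subr_gt0 ltr_pdivrMr// mul1r /K; have := sqr_ge0 C; lra.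
have rho1 : rho < 1.
  by rewrite /rho gtrBl divr_gt0// exprn_gt0.
(* A fourth root, because [Lfun2_geometric_series] expects squared norms decaying like
   [p ^+ (4 * k)]. *)
pose p := Num.sqrt (Num.sqrt rho).
have p4 : p ^+ 4 = rho.
  by rewrite (exprM p 2 2) !sqr_sqrtr ?sqrtr_ge0// ltW.
have p0 : 0 < p by rewrite !sqrtr_gt0.
have p1 : p < 1.
  by rewrite -[ltRHS]sqrtr1 ltr_sqrt// -[ltRHS]sqrtr1 ltr_sqrt.
pose stp (y : X -> R) t := 1 * y t + (- tau) * B y t.
have lstp y : y \in L2 -> stp y \in L2.
  by move=> ly; apply: Lfun2_comb => //; exact: lB.
have stp_le y : y \in L2 -> dot mu (stp y) (stp y) <= rho * dot mu y y.
  move=> ly; have ls := lstp _ ly; have lBy := lB _ ly.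
  rewrite (dot_combl _ _ ly lBy ls) (dotC mu y) (dotC mu (B y)).
  rewrite !(dot_combl _ _ ly lBy)// (dotC mu y (B y)).
  have h1 := Bc _ ly; have h2 := BK _ ly.
  have t1 : tau ^+ 2 * dot mu (B y) (B y) <= tau ^+ 2 * (K * dot mu y y).
    by rewrite ler_wpM2l// sqr_ge0.
  have t2 : tau * (c * dot mu y y) <= tau * dot mu (B y) y.
    by rewrite ler_wpM2l// /tau divr_ge0// ltW.
  have e1 : tau ^+ 2 * K = c ^+ 2 / K.
    by rewrite /tau; field; rewrite gt_eqF.
  have e2 : tau * c = c ^+ 2 / K by rewrite /tau; ring.
  rewrite mulrA e1 in t1; rewrite mulrA e2 in t2; rewrite /rho; lra.
(* The increments of the iteration started at 0; each one is [tau] times the current residual, as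
   [BS] confirms. *)
pose u := fix u n : X -> R := if n is m.+1 then stp (u m) else fun t => tau * g t.
have lu n : u n \in L2 by elim: n => [|n IHn]; [exact: Lfun2Z|exact: lstp].
have ud n : dot mu (u n) (u n) <= dot mu (u 0%N) (u 0%N) * p ^+ (4 * n).
  rewrite exprM p4; elim: n => [|n IHn]; first by rewrite expr0 mulr1.
  apply: le_trans (stp_le _ (lu n)) _; rewrite exprS mulrCA ler_wpM2l//.
  exact: ltW.
have p01 : 0 < p < 1 by rewrite p0.
have [x lx [E xE]] := Lfun2_geometric_series p01 lu ud.
exists x => //.
have lS n := Lfun2_series n lu.
(* The base case needs [A 0 = 0] almost everywhere, obtained from [hlin] with both coefficients
   0. *)
have BS n : {ae mu, forall t,
    B (fun r => series (u ^~ r) n) t = g t - tau^-1 * u n t}.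
  elim: n => [|n IHn].
    have := hlin 0 0 _ _ lx lx; apply: filterS => t.
    rewrite !mul0r addr0 /B => A0.
    rewrite (_ : (fun r => series (u ^~ r) 0) = fun r => 0 * x r + 0 * x r).
      by rewrite A0 /series/= big_geq// mulKf// subrr addr0.
    by apply/funext => r; rewrite /series/= big_geq//; ring.
  apply: filterS2 IHn (hlin 1 1 _ _ (lS n) (lu n)) => t.
  rewrite /B => IH.
  rewrite (_ : (fun r => 1 * series (u ^~ r) n + 1 * u n r)
    = (fun r => series (u ^~ r) n.+1)); last first.
    by apply/funext => r; rewrite /series/= big_nat_recr//= !mul1r.
  rewrite !mul1r => ->; rewrite [in LHS]/series/= big_nat_recr//=.
  rewrite -/(series (u ^~ t) n) addrACA IH /stp /B.
  by field.
have lAx := hA _ lx.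
pose h t := B x t - g t.
have lh : h \in L2 by apply: Lfun2B => //; exact: lB.
suff h0 : dot mu h h = 0.
  by apply: filterS (dot_eq0 lh h0) => t /eqP; rewrite subr_eq0 => /eqP.
(* With [e] the remainder of the series, [h = B e - tau^-1 * u n] almost everywhere; both terms
   decay geometrically, and boundedness of [B] stands in for passing to the limit inside [A]. *)
pose Q := 2 * K * E + 2 * tau ^- 2 * dot mu (u 0%N) (u 0%N).
have hQ n : dot mu h h <= Q * p ^+ (2 * n).
  have [ld xEn] := xE n.
  pose e t := x t - series (u ^~ t) n.
  have lBe := lB _ ld; have lv := Lfun2Z (- tau^-1) (lu n).
  have lr := Lfun2D lBe lv.
  rewrite (@dot_ae _ _ _ mu _ (fun t => B e t + (- tau^-1) * u n t) _
    (fun t => B e t + (- tau^-1) * u n t))//.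
  - apply: le_trans (ler_dotD lBe lv) _.
    rewrite (dotZl _ (lu n) lv) (dotC mu (u n)) (dotZl _ (lu n) (lu n)).
    have h1 := BK _ ld.
    have h2 : K * dot mu e e <= K * (E * p ^+ (2 * n)) by rewrite ler_wpM2l// ltW.
    have h3 : dot mu (u n) (u n) <= dot mu (u 0%N) (u 0%N) * p ^+ (2 * n).
      apply: le_trans (ud n) _; rewrite ler_wpM2l ?dot_ge0//.
      by rewrite ler_wiXn2l ?ltW// leq_mul2r orbT.
    have h4 : tau ^- 2 * dot mu (u n) (u n)
        <= tau ^- 2 * (dot mu (u 0%N) (u 0%N) * p ^+ (2 * n)).
      by rewrite ler_wpM2l// invr_ge0 sqr_ge0.
    rewrite (_ : - tau^-1 * (- tau^-1 * dot mu (u n) (u n))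
      = tau ^- 2 * dot mu (u n) (u n)); last by field.
    by rewrite /Q; rewrite -/e in h1; lra.
  - apply: filterS2 (BS n) (hlin 1 (-1) _ _ lx (lS n)) => t BSt.
    rewrite (_ : (fun r => 1 * x r + (-1) * series (u ^~ r) n) = e); last first.
      by apply/funext => r; rewrite /e; ring.
    move=> Aet; rewrite /h {2}/B Aet; rewrite /B in BSt.
    by rewrite /e; move: BSt; rewrite /B; lra.
  - apply: filterS2 (BS n) (hlin 1 (-1) _ _ lx (lS n)) => t BSt.
    rewrite (_ : (fun r => 1 * x r + (-1) * series (u ^~ r) n) = e); last first.
      by apply/funext => r; rewrite /e; ring.
    move=> Aet; rewrite /h {2}/B Aet; rewrite /B in BSt.
    by rewrite /e; move: BSt; rewrite /B; lra.
apply/eqP; rewrite eq_le dot_ge0 andbT.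
have cQ : geometric Q (p ^+ 2) n @[n --> \oo] --> 0.
  by apply: cvg_geometric; rewrite ger0_norm ?exprn_ge0 ?exprn_ilt1// ltW.
rewrite -(cvg_lim _ cQ)//; apply: limr_ge; first by apply/cvg_ex; exists 0.
by apply: nearW => n; rewrite /= -exprM.
Qed.

End L2_series.

(** * Schur multipliers *)

Section schur_multipliers.
Context (R : realType) (I : finType).
Implicit Types G H : I -> I -> R.

Definition psd G := forall c : I -> R, 0 <= \sum_i \sum_j c i * c j * G i j.

(** Stating positivity of [H] as an action on all [psd] forms makes stability under entrywise
    products a mere composition, so no matrix factorization is ever needed; the generators are the
    rank-one kernels. *)
Definition schur_multiplier H :=
  forall G, psd G -> psd (fun i j => G i j * H i j).

Lemma psd_cvg (G_ : nat -> I -> I -> R) G : (forall n, psd (G_ n)) ->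
  (forall i j, G_ n i j @[n --> \oo] --> G i j) -> psd G.
Proof.
move=> pG cG c.
have cS : \sum_i \sum_j c i * c j * G_ n i j @[n --> \oo]
    --> \sum_i \sum_j c i * c j * G i j.
  apply: (cvg_big add_continuous) => i _; apply: (cvg_big add_continuous) => j _.
  by apply: cvgM => //; exact: cvg_cst.
rewrite -(cvg_lim _ cS)//; apply: limr_ge.
  by apply/cvg_ex; eexists; exact: cS.
by apply: nearW => n; exact: pG.
Qed.

Lemma schur_multiplier_ext H H' : H =2 H' ->
  schur_multiplier H -> schur_multiplier H'.
Proof.
move=> HH' mH G pG c; have := mH G pG c.
by under eq_bigr do under eq_bigr do rewrite HH'.
Qed.

Lemma schur_multiplier_cvg (H_ : nat -> I -> I -> R) H :
  (forall n, schur_multiplier (H_ n)) ->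
  (forall i j, H_ n i j @[n --> \oo] --> H i j) -> schur_multiplier H.
Proof.
move=> mH cH G pG; apply: (psd_cvg (G_ := fun n i j => G i j * H_ n i j)).
  by move=> n; exact: mH.
by move=> i j; apply: cvgM => //; exact: cvg_cst.
Qed.

Lemma schur_multiplierD H H' : schur_multiplier H -> schur_multiplier H' ->
  schur_multiplier (fun i j => H i j + H' i j).
Proof.
move=> mH mH' G pG c; have := addr_ge0 (mH G pG c) (mH' G pG c).
rewrite -big_split/=; congr (_ <= _); apply: eq_bigr => i _.
by rewrite -big_split/=; apply: eq_bigr => j _; ring.
Qed.

Lemma schur_multiplierM H H' : schur_multiplier H -> schur_multiplier H' ->
  schur_multiplier (fun i j => H i j * H' i j).
Proof.
move=> mH mH' G pG c; have := mH' _ (mH _ pG) c.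
congr (_ <= _); apply: eq_bigr => i _; apply: eq_bigr => j _.
by rewrite -(mulrA (G i j)).
Qed.

Lemma schur_multiplier_rank1 (a : I -> R) : schur_multiplier (fun i j => a i * a j).
Proof.
move=> G pG c; have := pG (fun i => c i * a i); congr (_ <= _).
by apply: eq_bigr => i _; apply: eq_bigr => j _; ring.
Qed.

Lemma schur_multiplier_cst (b : R) : 0 <= b -> schur_multiplier (fun _ _ => b).
Proof.
move=> b0; apply: schur_multiplier_ext (schur_multiplier_rank1 (fun=> Num.sqrt b)).
by move=> i j; rewrite -expr2 sqr_sqrtr.
Qed.

Lemma schur_multiplierZ (b : R) H : 0 <= b -> schur_multiplier H ->
  schur_multiplier (fun i j => b * H i j).
Proof. by move=> b0; apply: schur_multiplierM; exact: schur_multiplier_cst. Qed.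

Lemma schur_multiplier_sum (J : Type) (r : seq J) (H_ : J -> I -> I -> R) :
  (forall k, schur_multiplier (H_ k)) ->
  schur_multiplier (fun i j => \sum_(k <- r) H_ k i j).
Proof.
move=> mH; elim: r => [|k r IHr].
  apply: schur_multiplier_ext (schur_multiplier_cst (lexx 0)) => i j.
  by rewrite big_nil.
apply: schur_multiplier_ext (schur_multiplierD (mH k) IHr) => i j.
by rewrite big_cons.
Qed.

Lemma schur_multiplierX n H : schur_multiplier H ->
  schur_multiplier (fun i j => H i j ^+ n).
Proof.
move=> mH; elim: n => [|n IHn].
  by apply: schur_multiplier_ext (schur_multiplier_cst ler01) => i j.
by apply: schur_multiplier_ext (schur_multiplierM mH IHn) => i j; rewrite exprS.
Qed.

Lemma schur_multiplier_geometric H : (forall i j, 0 <= H i j < 1) ->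
  schur_multiplier H -> schur_multiplier (fun i j => (1 - H i j)^-1).
Proof.
move=> H01 mH.
apply: (schur_multiplier_cvg (H_ := fun n i j => series (geometric 1 (H i j)) n)).
  move=> n; apply: schur_multiplier_sum => k.
  by apply: schur_multiplierZ => //; exact: schur_multiplierX.
move=> i j; rewrite -[_^-1]mul1r; apply: cvg_geometric_series.
by have /andP[h0 h1] := H01 i j; rewrite ger0_norm.
Qed.

Lemma schur_multiplier_expR H : schur_multiplier H ->
  schur_multiplier (fun i j => expR (H i j)).
Proof.
move=> mH.
apply: (schur_multiplier_cvg (H_ := fun n i j => series (exp_coeff (H i j)) n)).
  move=> n; apply: schur_multiplier_sum => k.
  apply: (schur_multiplier_ext (H := fun i j => k`!%:R^-1 * H i j ^+ k)).
    by move=> i j; rewrite mulrC.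
  by apply: schur_multiplierZ; [rewrite invr_ge0|exact: schur_multiplierX].
by move=> i j; exact: is_cvg_series_exp_coeff.
Qed.

End schur_multipliers.

(* Riemann sums of [z / (1 - l * z)] over [l] in [[0, 1]]; the left and the right
   sums differ by [z / m * ((1 - z)^-1 - 1)]. *)
Lemma cvg_riemann_ln (R : realType) (z : R) : 0 <= z < 1 ->
  \sum_(j < m.+1) z / m.+1%:R * (1 - j.+1%:R / m.+1%:R * z)^-1 @[m --> \oo]
    --> - ln (1 - z).
Proof.
move=> /andP[z0 z1].
pose v m j := 1 - j%:R / m.+1%:R * z : R.
have v_gt0 m j : (j <= m.+1)%N -> 0 < v m j.
  move=> jm; rewrite subr_gt0; apply: le_lt_trans z1.
  by rewrite ler_piMl// ler_pdivrMr// mul1r ler_nat.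
pose a m := \sum_(j < m.+1) z / m.+1%:R * (v m j.+1)^-1.
pose b m := \sum_(j < m.+1) z / m.+1%:R * (v m j)^-1.
have dv m j : v m j - v m j.+1 = z / m.+1%:R.
  rewrite /v; have : m.+1%:R != 0 :> R by rewrite pnatr_eq0.
  by move: m.+1%:R => N N0; rewrite -natr1; field.
have tel m : \sum_(j < m.+1) (ln (v m j) - ln (v m j.+1)) = - ln (1 - z).
  under eq_bigr do rewrite -opprB.
  rewrite sumrN -(big_mkord xpredT (fun j => ln (v m j.+1) - ln (v m j))).
  rewrite telescope_sumr// /v mul0r mul0r subr0 ln1 subr0.
  by rewrite divff ?pnatr_eq0// mul1r.
(* Applied to consecutive nodes in both orders, this brackets each telescoping term between its left
   and right Riemann summand. *)
have ln_le x y : 0 < x -> 0 < y -> ln x - ln y <= (x - y) / y :> R.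
  move=> x0 y0; rewrite -ln_div ?posrE//.
  have -> : x / y = 1 + (x - y) / y by field; rewrite gt_eqF.
  apply: le_ln1Dx; rewrite ltr_pdivlMr//; lra.
have hi m : - ln (1 - z) <= a m.
  rewrite -(tel m); apply: ler_sum => j _; rewrite -(dv m j); apply: ln_le.
    by apply: v_gt0; exact: ltnW.
  exact: v_gt0.
have lo m : b m <= - ln (1 - z).
  rewrite -(tel m); apply: ler_sum => j _; rewrite -(dv m j) -lerN2 opprB -mulNr opprB.
  by apply: ln_le; apply: v_gt0 => //; exact: ltnW.
have ab m : a m - b m = z / m.+1%:R * ((1 - z)^-1 - 1).
  rewrite /a /b -sumrB; under eq_bigr do rewrite -mulrBr.
  rewrite -mulr_sumr -(big_mkord xpredT (fun j => (v m j.+1)^-1 - (v m j)^-1)).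
  rewrite telescope_sumr// /v mul0r mul0r subr0 invr1.
  by rewrite divff ?pnatr_eq0// mul1r.
apply: (@squeeze_cvgr _ _ _ _ (fun=> - ln (1 - z))
  (fun m => - ln (1 - z) + z * ((1 - z)^-1 - 1) * m.+1%:R^-1)).
- apply: nearW => m; rewrite hi/=.
  by rewrite mulrAC -ab; have := lo m; rewrite /a /v; lra.
- exact: cvg_cst.
- rewrite -[X in _ --> X]addr0; apply: cvgD; first exact: cvg_cst.
  rewrite -[X in _ --> X](mulr0 (z * ((1 - z)^-1 - 1))).
  by apply: cvgM; [exact: cvg_cst|exact: cvg_harmonic].
Qed.

(** * Logarithms and negative powers of [1 - H] *)

Section power_multiplier.
Context (R : realType) (I : finType).

(** Each Riemann summand is a nonnegative multiple of [H] times the geometric series in [l * H] with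
    [0 < l <= 1], so it is already known to be a multiplier. *)
Lemma schur_multiplier_ln (H : I -> I -> R) : (forall i j, 0 <= H i j < 1) ->
  schur_multiplier H -> schur_multiplier (fun i j => - ln (1 - H i j)).
Proof.
move=> H01 mH.
apply: (@schur_multiplier_cvg _ _ (fun m i j => \sum_(k < m.+1)
    H i j / m.+1%:R * (1 - k.+1%:R / m.+1%:R * H i j)^-1)); last first.
  by move=> i j; exact: cvg_riemann_ln.
move=> m; apply: schur_multiplier_sum => k; apply: schur_multiplierM.
  have m0 : 0 <= m.+1%:R^-1 :> R by rewrite invr_ge0.
  apply: schur_multiplier_ext (schur_multiplierZ m0 mH) => i j.
  by rewrite mulrC.
have k0 : 0 <= k.+1%:R / m.+1%:R :> R by rewrite divr_ge0.
apply: schur_multiplier_geometric; last exact: schur_multiplierZ.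
move=> i j; have /andP[h0 h1] := H01 i j; rewrite mulr_ge0//=.
apply: le_lt_trans h1; rewrite ler_piMl// ler_pdivrMr// mul1r ler_nat.
exact: ltn_ord.
Qed.

Lemma schur_multiplier_powR (nu : R) (H : I -> I -> R) : 0 <= nu ->
  (forall i j, 0 <= H i j < 1) ->
  schur_multiplier H -> schur_multiplier (fun i j => (1 - H i j) `^ (- nu)).
Proof.
move=> nu0 H01 mH.
apply: schur_multiplier_ext (schur_multiplier_expR
  (schur_multiplierZ nu0 (schur_multiplier_ln H01 mH))) => i j.
have /andP[h0 h1] := H01 i j.
by rewrite /powR subr_eq0 gt_eqF// mulrN mulNr.
Qed.

End power_multiplier.

(** * Distance kernels on a uniform grid *)

Section grid_multiplier.
Context (R : realType).

Lemma schur_multiplier_tent (m : nat) :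
  schur_multiplier (fun i j : 'I_m.+1 => m%:R - `|i%:R - j%:R| : R).
Proof.
have sum_lt (M n : nat) : (n <= M)%N -> \sum_(k < M) (k < n)%:R = n%:R :> R.
  move=> nM; rewrite -natr_sum; congr (_%:R).
  rewrite -[RHS](minn_idPl nM) {nM}.
  elim: M => [|M IHM]; first by rewrite big_ord0 minn0.
  by rewrite big_ord_recr/= IHM; lia.
apply: (@schur_multiplier_ext _ _ (fun i j : 'I_m.+1 => \sum_(k < m)
    ((k < i)%:R * (k < j)%:R + (i <= k)%:R * (j <= k)%:R))).
  move=> i j.
  (* The products of indicators are those of [k < minn i j] and [maxn i j <= k], so the total is
     [minn i j + m - maxn i j]. *)
  transitivity (\sum_(k < m) ((k < minn i j)%:R + (1 - (k < maxn i j)%:R)) : R).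
    apply: eq_bigr => k _; rewrite -!natrM !mulnb -leq_min -geq_max.
    by rewrite [in (maxn i j <= k)%N]leqNgt; case: (k < maxn i j)%N; rewrite ?subrr ?subr0.
  rewrite big_split/= sumrB sumr_const card_ord !sum_lt.
  - have [ij|/ltnW ij] := leqP i j.
      rewrite ler0_norm ?subr_le0 ?ler_nat//.
      by rewrite opprB opprB addrC -addrA; congr (_ + _); rewrite addrC.
    rewrite ger0_norm ?subr_ge0 ?ler_nat//.
    by rewrite opprB addrC -addrA; congr (_ + _); rewrite addrC.
  - by rewrite geq_max; apply/andP; split; rewrite -ltnS.
  - by rewrite geq_min -ltnS ltn_ord.
apply: schur_multiplier_sum => k; apply: schur_multiplierD;
  exact: (@schur_multiplier_rank1 _ _ (fun i : 'I_m.+1 => _)).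
Qed.

Lemma schur_multiplier_grid (m : nat) (nu : R) : 0 <= nu ->
  schur_multiplier (fun i j : 'I_m.+1 => (1 + `|i%:R - j%:R|) `^ (- nu) : R).
Proof.
move=> nu0.
(* Dividing by [m.+1] instead of [m] keeps [H < 1] on the diagonal and gives
   [1 - H i j = (1 + |i - j|) / m.+1]; this is the origin of the shift by one mesh. *)
pose H (i j : 'I_m.+1) : R := m.+1%:R^-1 * (m%:R - `|i%:R - j%:R|).
have iN : 0 <= m.+1%:R^-1 :> R by rewrite invr_ge0.
have dm (i j : 'I_m.+1) : `|i%:R - j%:R| <= m%:R :> R.
  have im : i%:R <= m%:R :> R by rewrite ler_nat -ltnS.
  have jm : j%:R <= m%:R :> R by rewrite ler_nat -ltnS.
  have := ler0n R i; have := ler0n R j; rewrite ler_norml; lra.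
have H01 i j : 0 <= H i j < 1.
  rewrite /H mulr_ge0 ?subr_ge0//= mulrC ltr_pdivrMr// mul1r -natr1.
  by have := normr_ge0 (i%:R - j%:R : R); lra.
have := schur_multiplier_powR nu0 H01 (schur_multiplierZ iN (@schur_multiplier_tent m)).
move=> /(schur_multiplierZ (powR_ge0 m.+1%:R (- nu))).
apply: schur_multiplier_ext => i j.
have /andP[h0 h1] := H01 i j.
rewrite -powRM//; last by rewrite subr_ge0 ltW.
by congr (_ `^ _); rewrite /H -natr1; field; rewrite natr1 pnatr_eq0.
Qed.

End grid_multiplier.

(** * Weakly singular integrals *)

Section weakly_singular_integral.
Context (R : realType).
Local Notation leb := (@lebesgue_measure R).
Implicit Types (a c s r t : R).

Lemma measurable_normB_powR a s :
  measurable_fun setT (fun t : measurableTypeR R => `|t - s| `^ a).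
Proof.
apply: (measurableT_comp (measurable_powR _)) => //.
by apply: measurableT_comp => //; exact: measurable_funB.
Qed.

Lemma ler_powRN a x y : 0 <= a -> 0 < x -> x <= y -> y `^ (- a) <= x `^ (- a).
Proof.
move=> a0 x0 xy; have y0 := lt_le_trans x0 xy.
rewrite !powRN lef_pV2 ?posrE ?powR_gt0//.
by apply: ge0_ler_powR => //; rewrite nnegrE ltW.
Qed.

Lemma powRN0 a : 0 < a -> 0 `^ (- a) = 0 :> R.
Proof. by move=> a0; rewrite powR0// oppr_eq0 gt_eqF. Qed.

Lemma dyadic_shell r u : 0 < r -> 0 < u <= r ->
  exists k, r * 2^-1 ^+ k.+1 < u <= r * 2^-1 ^+ k.
Proof.
move=> r0 /andP[u0 ur].
have ex : exists k, r * 2^-1 ^+ k < u.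
  have h1 : `|2^-1 : R| < 1 by rewrite ger0_norm ?invr_ge0// invf_lt1// ltr1n.
  have /cvgr_lt/(_ u u0)[n _ /(_ n (leqnn n)) nu] := cvg_geometric r h1.
  by exists n.
have := ex_minnP ex; case=> -[|k] ku kmin.
  by move: ku; rewrite expr0 mulr1 ltNge ur.
exists k; rewrite ku/= leNgt; apply/negP => /kmin.
by rewrite ltnn.
Qed.

Let lebesgue_ball c r : 0 < r -> leb `[c - r, c + r]%classic = (2 * r)%:E.
Proof.
move=> r0; rewrite lebesgue_measure_itv/= lte_fin ltrD2l gtrN// -EFinB.
by congr EFin; ring.
Qed.

Let powR2_lt1 a : a < 1 -> 2 `^ (a - 1) < 1 :> R.
Proof.
move=> a1; rewrite -opprB powRN invf_lt1 ?powR_gt0//.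
have a1' : 0 < 1 - a by rewrite subr_gt0.
have := gt0_ltr_powR a1' _ _ (ltr1n R 2); rewrite powR1; apply;
  by rewrite nnegrE.
Qed.

Let centered_bound a s r : 0 < a -> a < 1 -> 0 < r ->
  (\int[leb]_(t in `[(s - r)%R, (s + r)%R]) (`|t - s| `^ (- a))%:E
    <= (2 * 2 `^ a / (1 - 2 `^ (a - 1)) * r `^ (1 - a))%:E)%E.
Proof.
move=> a0 a1 r0.
pose b k := (r * 2^-1 ^+ k.+1) `^ (- a).
pose B k := `[s - r * 2^-1 ^+ k, s + r * 2^-1 ^+ k]%classic : set R.
have rk k : 0 < r * 2^-1 ^+ k by rewrite mulr_gt0// exprn_gt0// invr_gt0.
have b0 k : 0 <= b k by exact: powR_ge0.
have pos t k : (0 <= (b k * \1_(B k) t)%:E)%E by rewrite lee_fin mulr_ge0.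
have dom t : t \in `[s - r, s + r] -> ((`|t - s| `^ (- a))%:E
    <= \sum_(0 <= k <oo) (b k * \1_(B k) t)%:E)%E.
  rewrite in_itv/= => /andP[t1 t2].
  (* The centre lies in no shell, but there the integrand is 0 by the convention on powers of 0. *)
  have [->|ts] := eqVneq t s.
    by rewrite subrr normr0 powRN0//; apply: nneseries_ge0 => k _ _; exact: pos.
  have u0 : 0 < `|t - s| <= r.
    by rewrite normr_gt0 subr_eq0 ts/= ler_norml; lra.
  have [k /andP[ku uk]] := dyadic_shell r0 u0.
  apply: le_trans (nneseries_lim_ge k.+1 (fun n _ _ => pos t n)).
  rewrite big_nat_recr//=; apply: (@le_trans _ _ (b k * \1_(B k) t)%:E).
    rewrite lee_fin indicE mem_set ?mulr1.
      by apply: ler_powRN; rewrite ?ltW.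
    by rewrite /B/= in_itv/=; move: uk; rewrite ler_norml; lra.
  by rewrite leeDr// sume_ge0.
have mB k : measurable (B k : set (measurableTypeR R)) by exact: measurable_itv.
have mb k : measurable_fun setT (fun t : measurableTypeR R => (b k * \1_(B k) t)%:E).
  by apply/measurable_EFinP/measurable_funM.
have gm : 0 <= (2 `^ (a - 1) : R) < 1 by rewrite powR_ge0/=; exact: powR2_lt1.
apply: (@le_trans _ _ (\int[leb]_t \sum_(0 <= k <oo) (b k * \1_(B k) t)%:E)%E).
  have mW D : measurable_fun (D : set (measurableTypeR R))
      (fun t => (\sum_(0 <= k <oo) (b k * \1_(B k) t)%:E)%E).
    by apply: measurable_funTS; apply: ge0_emeasurable_sum.
  have W0 t : (0 <= \sum_(0 <= k <oo) (b k * \1_(B k) t)%:E)%E.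
    by exact: nneseries_ge0.
  apply: (@le_trans _ _ (\int[leb]_(t in `[(s - r)%R, (s + r)%R])
      \sum_(0 <= k <oo) (b k * \1_(B k) t)%:E)%E); last first.
    exact: ge0_subset_integral.
  apply: ge0_le_integral => //.
  apply/measurable_EFinP/measurable_funTS; exact: measurable_normB_powR.
rewrite integral_nneseries//.
rewrite mulrAC -nneseries_geometric//.
apply: lee_nneseries => [k _ _|k _]; first exact: integral_ge0.
under eq_integral do rewrite EFinM.
rewrite ge0_integralZl//; last 2 first.
- by apply/measurable_EFinP; exact: measurable_indic.
- by rewrite lee_fin.
have -> : (\int[leb]_x (\1_(B k) x)%:E = (2 * (r * 2^-1 ^+ k))%:E)%E.
  by rewrite integral_indic// setIT; exact: lebesgue_ball.
rewrite -EFinM lee_fin.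
set q := 2^-1 ^+ k; have q0 : 0 < q by rewrite exprn_gt0// invr_gt0.
have -> : b k = (r * q) `^ (- a) * 2 `^ a.
  rewrite /b exprSr mulrA powRM ?invr_ge0//; last by rewrite mulr_ge0// ltW.
  congr (_ * _); rewrite -powR_inv1// -powRrM; congr (_ `^ _); ring.
have -> : (2 `^ (a - 1)) ^+ k = q `^ (1 - a).
  transitivity (2 `^ ((a - 1) * k%:R) : R).
    by rewrite powRrM powR_mulrn// powR_ge0.
  have -> : q = 2 `^ (- k%:R) by rewrite powR_invn// /q exprVn.
  have -> : (a - 1) * k%:R = - k%:R * (1 - a).
    by rewrite mulNr -mulrN opprB mulrC.
  by rewrite powRrM.
rewrite -[X in _ <= X]mulrA -(powRM _ (ltW r0) (ltW q0)).
rewrite le_eqVlt; apply/orP; left; apply/eqP.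
have -> : (r * q) `^ (1 - a) = (r * q) * (r * q) `^ (- a).
  have rq : 0 < r * q by exact: mulr_gt0.
  rewrite powRD; last by rewrite (gt_eqF rq) implybT.
  by rewrite powRr1// ltW.
ring.
Qed.

Lemma weakly_singular_bound a : 0 < a -> a < 1 -> exists2 C, 0 <= C &
  forall c s r, 0 < r ->
    (\int[leb]_(t in `[(c - r)%R, (c + r)%R]) (`|t - s| `^ (- a))%:E
      <= (C * r `^ (1 - a))%:E)%E.
Proof.
move=> a0 a1.
pose C := 2 * 2 `^ a / (1 - 2 `^ (a - 1)) : R.
have C0 : 0 <= C.
  rewrite divr_ge0 ?mulr_ge0 ?powR_ge0// subr_ge0 ltW//; exact: powR2_lt1.
exists (2 + C); first by rewrite addr_ge0.
move=> c s r r0.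
pose f t := `|t - s| `^ (- a).
have mf D : measurable_fun (D : set (measurableTypeR R)) (fun t => (f t)%:E).
  by apply/measurable_EFinP/measurable_funTS; exact: measurable_normB_powR.
have f0 t : (0 <= (f t)%:E)%E by rewrite lee_fin powR_ge0.
pose D := `[c - r, c + r]%classic : set (measurableTypeR R).
pose E := `[s - r, s + r]%classic : set (measurableTypeR R).
have mD : measurable D by exact: measurable_itv.
have mE : measurable E by exact: measurable_itv.
apply: (@le_trans _ _ (\int[leb]_(t in D) ((r `^ (- a))%:E + ((fun t => (f t)%:E) \_ E) t))%E).
  apply: ge0_le_integral => //.
  - apply: emeasurable_funD => //; apply: measurable_funTS.
    exact/(measurable_restrict _ mE measurableT).
  - move=> t _; rewrite patchE; case: ifPn => [_|].
      by rewrite leeDr// lee_fin powR_ge0.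
    rewrite -[point]/(0%:E) adde0 lee_fin => tE.
    apply: ler_powRN => //; first exact: ltW.
    rewrite leNgt; apply: contra tE; rewrite ltr_norml => /andP[h1 h2].
    by rewrite inE /E/= in_itv/=; apply/andP; split; lra.
rewrite ge0_integralD//; last 3 first.
- by move=> t _; rewrite lee_fin powR_ge0.
- by move=> t _; rewrite patchE; case: ifPn.
- by apply: measurable_funTS; exact/(measurable_restrict _ mE measurableT).
rewrite mulrDl EFinD; apply: leeD.
  rewrite integral_cst// [X in (_ * X)%E](lebesgue_ball c r0) -EFinM lee_fin mulrCA.
  have -> : r `^ (1 - a) = r `^ (- a) * r.
    rewrite addrC powRD; last by rewrite (gt_eqF r0) implybT.
    by rewrite powRr1// ltW.
  by [].
apply: (@le_trans _ _ (\int[leb]_(t in E) (f t)%:E)%E).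
  rewrite [leRHS]integral_mkcond; apply: ge0_subset_integral => //.
    exact/(measurable_restrict _ mE measurableT).
  by move=> t _; rewrite patchE; case: ifPn.
exact: centered_bound.
Qed.

End weakly_singular_integral.

(** * Kernels on an interval *)

Section interval_measure.
Context (R : realType).
Local Notation leb := (@lebesgue_measure R).
Local Notation RM := (measurableTypeR R).
Implicit Types (T M nu : R) (K L : R -> R -> R) (y : R -> R).

Lemma lebesgue_itv_lty T : (leb `[0%R, T]%classic < +oo)%E.
Proof. by rewrite lebesgue_measure_itv/=; case: ifPn => _; rewrite ?ltry. Qed.

(* Convertible to [lebesgue_on T], but carries the finite measure structure that
   product measures require. *)
Definition lebesgue_fin T : {finite_measure set RM -> \bar R} :=
  @mfrestr _ RM R _ leb (measurable_itv `[0, T]) (lebesgue_itv_lty T).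

Let fin_on T : (lebesgue_fin T : {measure set RM -> \bar R}) = lebesgue_on T.
Proof. by []. Qed.

Lemma ae_lebesgue_on T (P : R -> Prop) :
  (forall t, t \in `[0, T] -> P t) -> {ae lebesgue_on T, forall t, P t}.
Proof.
move=> TP; exists (~` `[0, T]); split.
- by apply: measurableC; exact: measurable_itv.
- rewrite /lebesgue_on/= /mrestr setICl; exact: measure0.
- move=> t /= nP tT; apply: nP; exact: TP.
Qed.

Lemma integral_lebesgue_on T (f : R -> \bar R) :
  measurable_fun (setT : set RM) f ->
  (\int[lebesgue_on T]_t f t = \int[leb]_(t in `[0%R, T]) f t)%E.
Proof.
move=> mf; have mD : measurable (`[0, T]%classic : set RM) by exact: measurable_itv.
transitivity (\int[lebesgue_on T]_(t in `[0%R, T]) f t)%E.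
  rewrite [RHS]integral_mkcond; apply: ae_eq_integral => //.
    by apply/(measurable_restrict _ mD measurableT); exact: measurable_funTS.
  by apply: ae_lebesgue_on => t tT _; rewrite patchE mem_set.
by apply: eq_measure_integral => A mA AT; rewrite /lebesgue_on/= /mrestr setIidl.
Qed.

Lemma integrable_lebesgue_on T (f : R -> \bar R) :
  measurable_fun (setT : set RM) f ->
  (lebesgue_on T).-integrable setT f <-> leb.-integrable `[0, T] f.
Proof.
move=> mf; have mf' : measurable_fun (setT : set RM) (abse \o f).
  exact: measurableT_comp.
split=> /integrableP[_ fi]; apply/integrableP; split.
- exact: measurable_funTS.
- by move: fi; rewrite integral_lebesgue_on.
- exact: mf.
- by rewrite integral_lebesgue_on.
Qed.

(** Extension by 0 turns conditions on [[0, T]] into the everywhere conditions (symmetry,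
    measurability, row bounds) under which Schur's test is set up. *)
Definition patched T K : RM * RM -> R := (fun p => K p.1 p.2) \_ (square T).

Lemma patchedE T K t s : t \in `[0, T] -> s \in `[0, T] ->
  patched T K (t, s) = K t s.
Proof. by move=> tT sT; rewrite /patched patchE mem_set. Qed.

Lemma patched_out T K t s : t \notin `[0, T] \/ s \notin `[0, T] ->
  patched T K (t, s) = 0.
Proof.
by move=> ts; rewrite /patched patchE memNset// => -[/= tT sT];
  case: ts; rewrite ?tT ?sT.
Qed.

Lemma measurable_square T : measurable (square T : set (RM * RM)).
Proof. by apply: measurableX; exact: measurable_itv. Qed.

Variables (T : R) (K : R -> R -> R).
Hypothesis mK : measurable_fun setT (patched T K).

Let mKy y t : measurable_fun (setT : set RM) y ->
  measurable_fun (setT : set RM) (fun s => (patched T K (t, s) * y s)%:E).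
Proof.
move=> my; apply/measurable_EFinP/measurable_funM => //.
exact: (measurable_fun_pair2 (t : RM)).
Qed.

Lemma integral_op_patched y : measurable_fun (setT : set RM) y ->
  integral_op T K y = kernel_op (lebesgue_fin T) (patched T K) y.
Proof.
move=> my; apply/funext => t; rewrite /integral_op patchE /kernel_op.
rewrite /Rintegral [in RHS]fin_on integral_lebesgue_on; last exact: mKy.
case: ifPn => [|/negP tT].
  rewrite inE/= => tT; congr fine; apply: eq_integral => s; rewrite inE/= => sT.
  by rewrite patchedE.
rewrite integral0_eq// => s _; rewrite patched_out ?mul0r//.
by left; apply/negP => tT'; apply: tT; rewrite inE.
Qed.

Lemma kernel_integrable_patched y t : measurable_fun (setT : set RM) y ->
  t \in `[0, T] ->
  kernel_integrable T K y t <->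
  (lebesgue_fin T).-integrable setT (fun s => (patched T K (t, s) * y s)%:E).
Proof.
move=> my tT; have IL := integrable_lebesgue_on T (mKy t my).
by split=> [|/IL] h; [apply/IL|]; move: h; apply: eq_integrable => // s;
  rewrite inE/= => sT; rewrite patchedE.
Qed.

End interval_measure.

(** * Sampling on a grid *)

Section grid.
Context (R : realType) (T : R) (T_gt0 : 0 < T).
Local Notation RM := (measurableTypeR R).
Implicit Types (t s : R) (L : R -> R -> R).

Definition node (N i : nat) : R := T * (i%:R / N%:R).
Definition cell_index (N : nat) t : nat := Num.truncn (t * N%:R / T).
Definition grid_point (N : nat) t : R := node N (cell_index N t).

(** Cells are half-open, so [T] is alone in the cell of index [N]; this is why a mesh of [T / N]
    uses [N.+1] indices. *)
Definition cell (N i : nat) : set RM :=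
  [set` `[0, T]] `&` [set` `[node N i, node N i.+1[].

Definition step_kernel (N : nat) (G : 'I_N.+1 -> 'I_N.+1 -> R) (p : RM * RM) : R :=
  \sum_(i < N.+1) \sum_(j < N.+1) G i j * \1_(cell N i) p.1 * \1_(cell N j) p.2.

Lemma measurable_cell N i : measurable (cell N i).
Proof. by apply: measurableI; exact: measurable_itv. Qed.

Lemma measurable_step_kernel N G : measurable_fun setT (@step_kernel N G).
Proof.
apply: measurable_sum => i; apply: measurable_sum => j.
apply: measurable_funM; first apply: measurable_funM => //.
  by apply: (measurableT_comp _ measurable_fst) => //; apply: measurable_indic; exact: measurable_cell.
by apply: (measurableT_comp _ measurable_snd) => //; apply: measurable_indic; exact: measurable_cell.
Qed.

Lemma cellP n i t : t \in `[0, T] ->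
  cell n.+1 i t <-> i = cell_index n.+1 t.
Proof.
rewrite in_itv/= => /andP[t0 tT].
have x0 : 0 <= t * n.+1%:R / T by rewrite divr_ge0 ?mulr_ge0// ltW.
have n0 : 0 < n.+1%:R :> R by rewrite ltr0n.
have iE : (node n.+1 i <= t < node n.+1 i.+1)
    = (i%:R <= t * n.+1%:R / T < i.+1%:R).
  rewrite /node ler_pdivlMr// ltr_pdivrMr//.
  by rewrite !mulrA ler_pdivrMr// ltr_pdivlMr// !(mulrC T).
rewrite /cell/= !in_itv/= t0 tT iE; split=> [[_ /truncn_def /esym]|->] //.
by split=> //; exact: truncn_itv.
Qed.

Lemma cell_index_lt n t : t \in `[0, T] -> (cell_index n.+1 t < n.+2)%N.
Proof.
rewrite in_itv/= => /andP[t0 tT].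
have x0 : 0 <= t * n.+1%:R / T by rewrite divr_ge0 ?mulr_ge0// ltW.
rewrite truncn_lt_nat// ltr_pdivrMr// mulrC.
apply: (@le_lt_trans _ _ (n.+1%:R * T)); first by rewrite ler_wpM2l.
by rewrite ltr_pM2r// ltr_nat.
Qed.

Lemma step_kernelE n G t s (tT : t \in `[0, T]) (sT : s \in `[0, T]) :
  step_kernel G (t, s)
  = G (Ordinal (cell_index_lt n tT)) (Ordinal (cell_index_lt n sT)).
Proof.
rewrite /step_kernel (bigD1 (Ordinal (cell_index_lt n tT)))//=.
rewrite [X in _ + X]big1 ?addr0 => [|i it]; last first.
  apply: big1 => j _; rewrite [\1_(cell _ i) t]indicE memNset ?mulr0 ?mul0r//.
  move=> /(cellP _ _ tT) iE; move/eqP : it; apply; exact: val_inj.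
rewrite (bigD1 (Ordinal (cell_index_lt n sT)))//=.
rewrite [X in _ + X]big1 ?addr0 => [|j js]; last first.
  rewrite [\1_(cell _ j) s]indicE memNset ?mulr0//.
  move=> /(cellP _ _ sT) jE; move/eqP : js; apply; exact: val_inj.
by rewrite !indicE !mem_set ?mulr1//; exact/cellP.
Qed.

Lemma step_kernel_out N G t s : t \notin `[0, T] \/ s \notin `[0, T] ->
  @step_kernel N G (t, s) = 0.
Proof.
move=> ts; apply: big1 => i _; apply: big1 => j _; case: ts => ts.
  rewrite [\1_(cell _ i) _]indicE memNset ?mulr0 ?mul0r// => -[/= tT _].
  by move: ts; rewrite tT.
rewrite [\1_(cell _ j) _]indicE memNset ?mulr0// => -[/= sT _].
by move: ts; rewrite sT.
Qed.

Lemma grid_point_bounds n t : t \in `[0, T] ->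
  grid_point n.+1 t <= t < grid_point n.+1 t + T / n.+1%:R.
Proof.
move=> tT; have [_ /= ] := (cellP n (cell_index n.+1 t) tT).2 erefl.
rewrite in_itv/= => /andP[-> h]; rewrite /=; apply: lt_le_trans h _.
by rewrite /grid_point /node -natr1 mulrDl mulrDr mul1r.
Qed.

Lemma grid_point_itv n t : t \in `[0, T] -> grid_point n.+1 t \in `[0, T].
Proof.
move=> tT; have /andP[h _] := grid_point_bounds n tT.
move: tT; rewrite !in_itv/= => /andP[_ tT]; rewrite (le_trans h tT) andbT.
by rewrite /grid_point /node mulr_ge0 ?divr_ge0// ltW.
Qed.

Lemma node_itv N (i : 'I_N.+2) : node N.+1 i \in `[0, T].
Proof.
have T0 := ltW T_gt0; rewrite in_itv/= /node mulr_ge0 ?divr_ge0//=.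
by rewrite ler_piMr// ler_pdivrMr// mul1r ler_nat -ltnS.
Qed.

Lemma cvg_grid_point t : t \in `[0, T] -> grid_point n.+1 t @[n --> \oo] --> t.
Proof.
move=> tT; apply: (@squeeze_cvgr _ _ _ _ (fun n => t - T * n.+1%:R^-1) (fun=> t)).
- apply: nearW => n; have /andP[h1 h2] := grid_point_bounds n tT.
  by rewrite h1 andbT lerBlDr ltW.
- rewrite -[X in _ --> X]subr0; apply: cvgB; first exact: cvg_cst.
  rewrite -[X in _ --> X](mulr0 T); apply: cvgM; first exact: cvg_cst.
  exact: cvg_harmonic.
- exact: cvg_cst.
Qed.

(** Grid points may fall into [S], where nothing is known about [L]. Since [S] is finite, hence
    closed, and misses [(t, s)], they eventually avoid it. *)
Lemma cvg_grid_continuous L (S : set (R * R)) t s : finite_set S ->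
  {within square T `\` S, continuous (fun p => L p.1 p.2)} ->
  t \in `[0, T] -> s \in `[0, T] -> ~ S (t, s) ->
  L (grid_point n.+1 t) (grid_point n.+1 s) @[n --> \oo] --> L t s.
Proof.
move=> fS cL tT sT tsS.
have cp : (grid_point n.+1 t, grid_point n.+1 s) @[n --> \oo] --> (t, s).
  exact: cvg_pair (cvg_grid_point tT) (cvg_grid_point sT).
have := (subspace_continuousP _ _).1 cL (t, s) (conj (conj tT sT) tsS).
apply: cvg_trans.
have cw : (grid_point n.+1 t, grid_point n.+1 s) @[n --> \oo]
    --> within (square T `\` S) (nbhs (t, s)).
  move=> U tU.
  have {}tU : nbhs (t, s) [set p | (square T `\` S) p -> U p] := tU.
  have oS : nbhs (t, s) (~` S).
    apply: open_nbhs_nbhs; split => //; apply: closed_openC.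
    have haus : hausdorff_space (R * R)%type by exact: norm_hausdorff.
    exact: (accessible_finite_set_closed.1 (hausdorff_accessible haus)).
  have tUS : nbhs (t, s) ([set p | (square T `\` S) p -> U p] `&` ~` S).
    exact: filterI.
  change (\forall n \near \oo, U (grid_point n.+1 t, grid_point n.+1 s)).
  have : \forall n \near \oo, ([set p | (square T `\` S) p -> U p] `&` ~` S)
    (grid_point n.+1 t, grid_point n.+1 s) := cp _ tUS.
  apply: filterS => n /= [h1 h2].
  by apply: h1; split => //; split; exact: grid_point_itv.
move=> U tU.
have H : within (square T `\` S) (nbhs (t, s)) ((fun p => L p.1 p.2) @^-1` U) := tU.
exact: (cw _ H).
Qed.

End grid.

(** * Measurability and row integrals of singular kernels *)

Section kernels_on_interval.
Context (R : realType) (T : R) (T_gt0 : 0 < T).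
Local Notation leb := (@lebesgue_measure R).
Local Notation RM := (measurableTypeR R).
Local Notation mu := (lebesgue_fin T).
Implicit Types (t s nu M : R) (L : R -> R -> R).

Lemma measurable_finite_pairs (S : set (RM * RM)) : finite_set S -> measurable S.
Proof.
move=> fS; apply: countable_measurable => [[a b]|]; last exact: finite_set_countable.
rewrite (_ : [set (a, b)] = [set a] `*` [set b]).
  by apply: measurableX; exact: measurable_set1.
by apply/seteqP; split=> [[x y] [-> ->]//|[x y] [/= -> ->]].
Qed.

(** Off [S] the function is a pointwise limit of step kernels sampling [L]; on the finite set [S]
    every subset is measurable. *)
Lemma measurable_patched L : continuous_except_finite T L ->
  measurable_fun setT (patched T L).
Proof.
move=> [S fS cL]; have mS := measurable_finite_pairs fS.
rewrite -(setUv S); apply/measurable_funU => //; first exact: measurableC.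
split.
  move=> _ Y mY; apply: measurable_finite_pairs.
  by apply: sub_finite_set fS; exact: subIsetl.
apply: (@measurable_fun_cvg _ _ _ _ (fun n (p : RM * RM) => step_kernel T
    (fun i j : 'I_n.+2 => L (node T n.+1 i) (node T n.+1 j)) p)).
  by move=> n; apply: measurable_funTS; exact: measurable_step_kernel.
move=> [t s] /= nS.
have [/andP[tT sT]|out] := boolP ((t \in `[0, T]) && (s \in `[0, T])); last first.
  move: out; rewrite negb_and => /orP out.
  rewrite patched_out// (_ : (fun n => _) = fun=> 0); first exact: cvg_cst.
  by apply/funext => n; rewrite step_kernel_out.
rewrite patchedE//; under eq_fun do rewrite (step_kernelE T_gt0 _ tT sT).
exact: (cvg_grid_continuous T_gt0 fS cL).
Qed.

Lemma patched_kernelE nu L p :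
  patched T (kernel_of nu L) p = patched T L p * `|p.1 - p.2| `^ (- nu).
Proof.
rewrite /patched !patchE /kernel_of; case: ifPn => _; first by rewrite powRN.
by rewrite mul0r.
Qed.

Lemma measurable_patched_kernel nu L : measurable_fun setT (patched T L) ->
  measurable_fun setT (patched T (kernel_of nu L)).
Proof.
move=> mL; rewrite (_ : patched _ _ = fun p => patched T L p * `|p.1 - p.2| `^ (- nu)).
  apply: measurable_funM => //.
  apply: (measurableT_comp (measurable_powR _)) => //.
  by apply: measurableT_comp => //; exact: measurable_funB.
by apply/funext => p; rewrite patched_kernelE.
Qed.

Lemma patched_kernel_sym nu L : symmetric_on T L -> forall t s : RM,
  patched T (kernel_of nu L) (t, s) = patched T (kernel_of nu L) (s, t).
Proof.
move=> sL t s; rewrite !patched_kernelE/= distrC; congr (_ * _).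
have [/andP[tT sT]|out] := boolP ((t \in `[0, T]) && (s \in `[0, T])); last first.
  move: out; rewrite negb_and => /orP out; rewrite !patched_out//.
  by case: out; [right|left].
by rewrite !patchedE// sL.
Qed.

(** One estimate with two uses: exponent [nu] yields operator norms, exponent [nu * (nu^-1 - delta)]
    yields the admissibility integrals. *)
Lemma singular_integral_le a : 0 < a -> a < 1 -> exists2 C, 0 <= C &
  forall (cs : seq R) (r B t : R) (f : R -> R), 0 < r -> 0 <= B ->
    measurable_fun (`[0, T]%classic : set RM) f ->
    (forall s, s \in `[0, T] -> 0 <= f s <=
      B * (\sum_(c <- cs) \1_(`[c - r, c + r]) s) * `|t - s| `^ (- a)) ->
    (\int[leb]_(s in `[0%R, T]) (f s)%:E
      <= (B * (size cs)%:R * C * r `^ (1 - a))%:E)%E.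
Proof.
move=> a0 a1; have [C C0 hC] := weakly_singular_bound a0 a1.
exists C => // cs r B t f r0 B0 mf fB.
have mI c : measurable (`[c - r, c + r]%classic : set RM) by exact: measurable_itv.
pose h c s : \bar R := (B * (\1_(`[c - r, c + r]) s * `|t - s| `^ (- a)))%:E.
have mh c : measurable_fun (setT : set RM) (h c).
  apply/measurable_EFinP/measurable_funM => //; apply: measurable_funM => //.
  by under eq_fun do rewrite distrC; exact: measurable_normB_powR.
have h0 c s : (0 <= h c s)%E by rewrite lee_fin !mulr_ge0// powR_ge0.
have D0 : measurable (`[0, T]%classic : set RM) by exact: measurable_itv.
apply: (@le_trans _ _ (\int[leb]_(s in `[0%R, T]) \sum_(c <- cs) h c s)%E).
  apply: ge0_le_integral => //.
  - by move=> s /fB/andP[].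
  - exact/measurable_EFinP.
  - by apply: measurable_funTS; exact: emeasurable_sum.
  - move=> s /fB/andP[_ /le_trans]; rewrite /h sumEFin lee_fin; apply.
    by rewrite -mulrA mulr_suml mulr_sumr.
apply: (@le_trans _ _ (\int[leb]_s \sum_(c <- cs) h c s)%E).
  apply: ge0_subset_integral => //.
    by apply: emeasurable_sum.
  by move=> s _; exact: sume_ge0.
rewrite ge0_integral_sum//.
have hc c : (\int[leb]_s h c s <= (B * C * r `^ (1 - a))%:E)%E.
  rewrite (_ : (\int[leb]_s h c s)%E = (B%:E *
      \int[leb]_(s in `[(c - r)%R, (c + r)%R]) (`|s - t| `^ (- a))%:E)%E).
    by rewrite -mulrA EFinM lee_wpmul2l// ?lee_fin//; exact: hC.
  rewrite [X in (_ * X)%E]integral_mkcond -ge0_integralZl//; last 2 first.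
  - by apply/(measurable_restrict _ (mI c) measurableT)/measurable_EFinP/measurable_funTS;
      exact: measurable_normB_powR.
  - by move=> s _; rewrite patchE; case: ifPn => // _; rewrite lee_fin powR_ge0.
  apply: eq_integral => s _; rewrite /h patchE indicE distrC.
  by case: ifPn => _; rewrite ?mul1r ?mul0r ?EFinM// mule0.
apply: (@le_trans _ _ (\sum_(c <- cs) (B * C * r `^ (1 - a))%:E)%E).
  by apply: lee_sum => c _; exact: hc.
rewrite sumEFin lee_fin big_const_seq count_predT iter_addr_0 -mulr_natr.
by rewrite le_eqVlt; apply/orP; left; apply/eqP; ring.
Qed.

End kernels_on_interval.

(** * Positivity *)

Lemma cvg_powR (R : realType) (u : nat -> R) (l a : R) : (forall n, 0 < u n) -> 0 < l ->
  u n @[n --> \oo] --> l -> u n `^ a @[n --> \oo] --> l `^ a.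
Proof.
move=> u0 l0 ul; rewrite /powR (gt_eqF l0).
under eq_fun do rewrite (gt_eqF (u0 _)).
apply: (@continuous_cvg _ R R \oo _ (fun n => a * ln (u n)) expR).
  exact: continuous_expR.
apply: cvgM; first exact: cvg_cst.
by apply: (@continuous_cvg _ R R \oo _ u (@ln R)) => //; exact: continuous_ln.
Qed.

Section positivity.
Context (R : realType) (T : R) (T_gt0 : 0 < T).
Local Notation leb := (@lebesgue_measure R).
Local Notation RM := (measurableTypeR R).
Local Notation mu := (lebesgue_fin T).
Local Notation L2T := (Lfun mu 2%:E).
Implicit Types (t s : R) (y z : R -> R).

Let muT_ge0 : 0 <= fine (mu setT).
Proof. by apply: fine_ge0; exact: measure_ge0. Qed.

(** An instance of the Fubini statements of Schur's test, for the kernel constantly 1, whose row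
    integrals equal the finite total mass. *)
Lemma integral_prod_fun y z : y \in L2T -> z \in L2T ->
  (mu \x mu)%E.-integrable setT (fun p : RM * RM => (y p.2 * z p.1)%:E) /\
  (\int[mu \x mu]_p (y p.2 * z p.1)%:E
    = ((\int[mu]_s y s) * (\int[mu]_t z t))%:E)%E.
Proof.
move=> ly lz.
have one_bound t : (\int[mu]_s `|cst 1%R (t, s)|%:E <= (fine (mu setT))%:E)%E.
  rewrite /= normr1 integral_cst// mul1e fineK//; exact: fin_num_measure.
have m1 : measurable_fun setT (cst 1 : RM * RM -> R) by exact: measurable_cst.
have iP := kernel_op_prod_integrable m1 (fun _ _ => erefl) muT_ge0 one_bound ly lz.
have E p : (cst 1 p : R) * y p.2 * z p.1 = y p.2 * z p.1 by rewrite mul1r.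
split.
  by move: iP; apply: eq_integrable => // p _; rewrite E.
have := kernel_op_dotE m1 (fun _ _ => erefl) muT_ge0 one_bound ly lz.
under [in RHS]eq_integral do rewrite E.
move=> <-; rewrite /dot; congr EFin.
have l1 : cst 1 \in L2T by exact: Lfun_cst.
have iz : mu.-integrable setT (EFin \o z).
  by have := Lfun2_mul_integrable l1 lz; under eq_fun do rewrite mul1r.
rewrite -(RintegralZl _ measurableT iz).
apply: eq_Rintegral => t _; congr (_ * _).
by rewrite /kernel_op; under eq_Rintegral do rewrite mul1r.
Qed.

(** The integral is the quadratic form of [G] at the vector of integrals of [y] over the cells, so
    [y] need not be sampled and may be any square-integrable function. *)
Lemma integral_step_kernel N (G : 'I_N.+1 -> 'I_N.+1 -> R) y : y \in L2T -> psd G ->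
  (0 <= \int[mu \x mu]_p (step_kernel T G p * y p.2 * y p.1)%:E)%E.
Proof.
move=> ly pG.
pose yi (i : 'I_N.+1) t := \1_(cell T N i) t * y t.
have lyi i : yi i \in L2T.
  apply: (Lfun2_dom _ ly).
    apply: measurable_funM; last exact: Lfun2_measurable ly.
    apply: measurable_indic; exact: measurable_cell.
  apply: aeW => t; rewrite normrM ler_piMl// indicE.
  by case: (_ \in _); rewrite ?normr1 ?normr0.
have E (p : RM * RM) : (step_kernel T G p * y p.2 * y p.1)%:E
    = (\sum_(i < N.+1) \sum_(j < N.+1) (G i j)%:E * (yi j p.2 * yi i p.1)%:E)%E.
  rewrite /step_kernel !mulr_suml -sumEFin; apply: eq_bigr => i _.
  rewrite !mulr_suml -sumEFin; apply: eq_bigr => j _.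
  by rewrite -EFinM /yi; congr EFin; ring.
under eq_integral do rewrite E.
have iij i j : (mu \x mu)%E.-integrable setT
    (fun p : RM * RM => (G i j)%:E * (yi j p.2 * yi i p.1)%:E)%E.
  by apply: integrableZl => //; exact: (integral_prod_fun (lyi j) (lyi i)).1.
rewrite integral_sum//; last by move=> i; apply: integrable_sum => // j _; exact: iij.
under eq_bigr do rewrite integral_sum//.
have -> : (\sum_(i < N.+1) \sum_(j < N.+1)
    \int[mu \x mu]_p ((G i j)%:E * (yi j p.2 * yi i p.1)%:E)
  = (\sum_(i < N.+1) \sum_(j < N.+1)
    (\int[mu]_t yi i t) * (\int[mu]_t yi j t) * G i j)%:E)%E.
  rewrite -sumEFin; apply: eq_bigr => i _; rewrite -sumEFin; apply: eq_bigr => j _.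
  rewrite integralZl//; last exact: (integral_prod_fun (lyi j) (lyi i)).1.
  rewrite (integral_prod_fun (lyi j) (lyi i)).2 -EFinM.
  by congr EFin; ring.
by rewrite lee_fin; exact: pG.
Qed.

(** Each section at [t] is contained in [t] together with the second coordinates of [S], a finite
    and hence null set. *)
Lemma negligible_diag_finite (S : set (R * R)) : finite_set S ->
  {ae (mu \x mu)%E, forall p : RM * RM, p.1 != p.2 /\ ~ S p}.
Proof.
move=> fS; pose B : set (RM * RM) := [set p | p.1 = p.2] `|` S.
have mB : measurable B.
  apply: measurableU; last exact: measurable_finite_pairs.
  rewrite (_ : [set p | p.1 = p.2]
      = setT `&` (fun p : RM * RM => p.1 - p.2) @^-1` [set 0]).
    by apply: measurable_funB => //; exact: measurable_set1.
  apply/seteqP; split=> [p /= ->|p [_ /= /eqP]]; first by rewrite subrr.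
  by rewrite subr_eq0 => /eqP.
exists B; split => //.
- apply: integral0_eq => t _ /=.
  have cB : countable (xsection B t).
    apply: finite_set_countable.
    apply: (@sub_finite_set _ _ ([set t] `|` snd @` S)).
      move=> s /xsectionP [/= ->|Sts]; [by left|right].
      by exists (t, s).
    by rewrite finite_setU; split => //; exact: finite_image.
  apply/eqP; rewrite eq_le measure_ge0 andbT.
  rewrite -(countable_lebesgue_measure0 cB); apply: le_measure; rewrite ?inE.
  + apply: measurableI; [exact: measurable_xsection|exact: measurable_itv].
  + exact: measurable_xsection.
  + exact: subIsetl.
- move=> p /= /not_andP[/negP|/contrapT pS]; last by right.
  by rewrite negbK => /eqP; left.
Qed.

End positivity.

(** * Row bounds and positivity of the weakly singular operator *)

Section weakly_singular_operator.
Context (R : realType) (T : R) (T_gt0 : 0 < T) (nu : R).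
Hypotheses (nu_gt0 : 0 < nu) (nu_lt1 : nu < 1).
Local Notation RM := (measurableTypeR R).
Local Notation mu := (lebesgue_fin T).
Local Notation L2T := (Lfun mu 2%:E).
Implicit Types (t s M : R) (y z : R -> R) (L : R -> R -> R).

(* [D] has the shape of [L - L_n]: it is bounded and it vanishes unless [s] is
   within [r] of one of the points of [cs]. *)
Lemma kernel_schur_local : exists2 C, 0 <= C & forall (cs : seq R) (r B : R) D,
  0 < r -> 0 <= B -> measurable_fun setT (patched T D) ->
  (forall t s, t \in `[0, T] -> s \in `[0, T] ->
    `|D t s| <= B * (\sum_(c <- cs) \1_(`[c - r, c + r]) s)) ->
  forall t : RM, (\int[mu]_s `|patched T (kernel_of nu D) (t, s)|%:E
    <= (B * (size cs)%:R * C * r `^ (1 - nu))%:E)%E.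
Proof.
have [C C0 hC] := singular_integral_le T nu_gt0 nu_lt1.
exists C => // cs r B D r0 B0 mD DB t.
have mk : measurable_fun (setT : set RM) (fun s => `|patched T (kernel_of nu D) (t, s)|).
  apply: measurableT_comp => //; apply: (measurable_fun_pair2 (t : RM)).
  exact: measurable_patched_kernel.
rewrite [leLHS](integral_lebesgue_on T); last exact/measurable_EFinP.
have [tT|tT] := boolP (t \in `[0, T]).
  apply: (hC cs r B t) => //; first exact: measurable_funTS.
  move=> s sT; rewrite normr_ge0/= patched_kernelE patchedE//= normrM.
  by rewrite [`|_ `^ _|]ger0_norm ?powR_ge0// ler_wpM2r ?powR_ge0//; exact: DB.
rewrite integral0_eq => [|s _]; last by rewrite patched_out ?normr0//; left.
by rewrite lee_fin !mulr_ge0// powR_ge0.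
Qed.

Lemma kernel_schur : exists2 C, 0 <= C & forall M L, 0 <= M ->
  bounded_by T M L -> measurable_fun setT (patched T L) ->
  forall t : RM, (\int[mu]_s `|patched T (kernel_of nu L) (t, s)|%:E
    <= (M * C)%:E)%E.
Proof.
have [C C0 hC] := kernel_schur_local.
have T2 : 0 < T / 2 by rewrite divr_gt0.
exists (C * (T / 2) `^ (1 - nu)); first by rewrite mulr_ge0// powR_ge0.
move=> M L M0 LM mL t; rewrite mulrA.
(* A single interval, centred at [T / 2] with radius [T / 2], covers [[0, T]], so the local bound
   becomes global. *)
have := hC [:: T / 2] (T / 2) M L T2 M0 mL; rewrite mulr1; apply.
move=> t' s t'T sT; rewrite big_seq1 indicE mem_set ?mulr1; first exact: LM.
by move: sT; rewrite /= !in_itv/= => /andP[s0 sT]; apply/andP; split; lra.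
Qed.

Variables (M : R) (L : R -> R -> R).
Hypotheses (L_bounded : bounded_by T M L) (L_symmetric : symmetric_on T L)
  (L_continuous : continuous_except_finite T L)
  (L_posdef : positive_definite T L).

(* The step kernel samples [L] at grid points and replaces [|t - s| ^- nu] by
   [(h + |t - s|) ^- nu] with [h] the mesh, which is a Schur multiplier on the
   grid and is dominated by [|t - s| ^- nu] off the grid. *)
Lemma kernel_op_ge0 y : y \in L2T ->
  0 <= dot mu (kernel_op mu (patched T (kernel_of nu L)) y) y.
Proof.
move=> ly; have my : measurable_fun (setT : set RM) y := Lfun2_measurable ly.
have T0T : 0 \in `[0, T] by rewrite in_itv/= lexx ltW.
have M0 : 0 <= M by apply: le_trans (L_bounded T0T T0T).
have [C C0 hC] := kernel_schur.
have mL := measurable_patched T_gt0 L_continuous.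
have mk := measurable_patched_kernel nu mL.
have ksym := @patched_kernel_sym _ _ nu _ L_symmetric.
have MC0 : 0 <= M * C by rewrite mulr_ge0.
have kC := hC M L M0 L_bounded mL.
(* The kernel built from the constant [M] is the integrable majorant for dominated convergence. *)
pose Lc : R -> R -> R := fun _ _ => M.
have mLc : measurable_fun setT (patched T Lc).
  by apply/(measurable_restrict _ (measurable_square T) measurableT).
have mk0 := measurable_patched_kernel nu mLc.
have k0sym : forall t s : RM, patched T (kernel_of nu Lc) (t, s) = patched T (kernel_of nu Lc) (s, t).
  exact: patched_kernel_sym.
have LcM : bounded_by T M Lc by move=> t s _ _; rewrite /Lc ger0_norm.
have k0C := hC M Lc M0 LcM mLc.
have lny : (fun t => `|y t|) \in L2T.
  apply: (Lfun2_dom _ ly); first exact: measurableT_comp.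
  by apply: aeW => t; rewrite normr_id.
have iD := kernel_op_prod_integrable mk0 k0sym MC0 k0C lny lny.
rewrite -lee_fin (kernel_op_dotE mk ksym MC0 kC ly ly).
pose h n : R := T / n.+1%:R.
have h0 n : 0 < h n by rewrite divr_gt0.
(* Nodes differ by multiples of [h n], so the second factor equals [h n]^ (-
   nu)[times the grid multiplier](1 + |i - j|) [^ (- nu)]. *)
pose G n (i j : 'I_n.+2) : R := L (node T n.+1 i) (node T n.+1 j)
  * (h n + `|node T n.+1 i - node T n.+1 j|) `^ (- nu).
have pG n : psd (@G n).
  have pL : psd (fun i j : 'I_n.+2 => L (node T n.+1 i) (node T n.+1 j)).
    move=> c; apply: (L_posdef (t := fun i : 'I_n.+2 => node T n.+1 i)) => // i.
    exact: node_itv.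
  have := schur_multiplierZ (powR_ge0 (h n) (- nu))
    (@schur_multiplier_grid R n.+1 nu (ltW nu_gt0)).
  move=> /(_ _ pL); congr psd; apply/funext => i; apply/funext => j.
  rewrite /G -powRM ?(ltW (h0 n)) ?addr_ge0//.
  congr (_ * _ `^ _); rewrite mulrDr mulr1; congr (_ + _).
  rewrite /node -mulrBr -mulrBl !normrM [`|T|]ger0_norm ?(ltW T_gt0)//.
  by rewrite [`|_^-1|]ger0_norm// /h; ring.
have [S fS cL] := L_continuous.
have lim : (\int[mu \x mu]_p (step_kernel T (@G n) p * y p.2 * y p.1)%:E)%E @[n --> \oo]
   --> (\int[mu \x mu]_p (patched T (kernel_of nu L) p * y p.2 * y p.1)%:E)%E.
  have mprod (k : RM * RM -> R) : measurable_fun setT k ->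
      measurable_fun setT (fun p : RM * RM => (k p * y p.2 * y p.1)%:E).
    move=> ?; apply/measurable_EFinP; apply: measurable_funM.
      by apply: measurable_funM => //; exact: (measurableT_comp my measurable_snd).
    exact: (measurableT_comp my measurable_fst).
  have /= := @dominated_convergence _ _ _ (mu \x mu)%E setT measurableT
    (fun n p => (step_kernel T (@G n) p * y p.2 * y p.1)%:E)
    (fun p => (patched T (kernel_of nu L) p * y p.2 * y p.1)%:E)
    (fun p => (patched T (kernel_of nu Lc) p * `|y p.2| * `|y p.1|)%:E).
  case=> //.
  - by move=> n; apply: mprod; exact: measurable_step_kernel.
  - exact: mprod.
  - apply: filterS (negligible_diag_finite T fS) => -[t s] /= [ts tsS] _.
    apply: cvg_EFin; first exact: nearW.
    apply: cvgM; last exact: cvg_cst.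
    apply: cvgM; last exact: cvg_cst.
    have [/andP[tT sT]|out] := boolP ((t \in `[0, T]) && (s \in `[0, T])); last first.
      move: out; rewrite negb_and => /orP out.
      rewrite patched_out// (_ : (fun n => _) = fun=> 0); first exact: cvg_cst.
      by apply/funext => n; rewrite step_kernel_out.
    rewrite patched_kernelE patchedE//=.
    under eq_fun do rewrite (step_kernelE T_gt0 _ tT sT).
    apply: cvgM; first exact: (cvg_grid_continuous T_gt0 fS cL).
    apply: cvg_powR.
    - by move=> n; rewrite ltr_wpDr.
    - by rewrite normr_gt0 subr_eq0.
    - rewrite -[X in _ --> X]add0r; apply: cvgD.
        rewrite -[X in _ --> X](mulr0 T); apply: cvgM; first exact: cvg_cst.
        exact: cvg_harmonic.
      by apply: cvg_norm; apply: cvgB; exact: cvg_grid_point.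
  (* The diagonal must be left out: there the majorant is 0 by convention, while the step kernel
     need not vanish. *)
  - apply: filterS (negligible_diag_finite T fS) => -[t s] /= [ts tsS] n _.
    rewrite lee_fin !normrM ler_wpM2r// ler_wpM2r//.
    have [/andP[tT sT]|out] := boolP ((t \in `[0, T]) && (s \in `[0, T])); last first.
      move: out; rewrite negb_and => /orP out.
      by rewrite patched_out// step_kernel_out// normr0.
    rewrite patched_kernelE patchedE//= (step_kernelE T_gt0 _ tT sT) normrM.
    rewrite [`|_ `^ _|]ger0_norm ?powR_ge0//; apply: ler_pM => //.
    - exact: powR_ge0.
    - by apply: L_bounded; exact: node_itv.
    (* Both points exceed their grid points by less than [h n], so [|t - s|] is at most [h n] plus
       the distance of the grid points. *)
    have /andP[t1 t2] := grid_point_bounds T_gt0 n tT.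
    have /andP[s1 s2] := grid_point_bounds T_gt0 n sT.
    apply: ler_powRN; rewrite ?normr_gt0 ?subr_eq0// ?(ltW nu_gt0)//.
    move: t1 t2 s1 s2; rewrite /grid_point -/(h n) /=.
    move: (node _ _ _) (node _ _ _) (h n) => a b e t1 t2 s1 s2.
    have := ler_norm (a - b); have := ler_norm (b - a).
    rewrite (distrC b a) => u1 u2; rewrite ler_norml; lra.
rewrite -(cvg_lim _ lim)//; apply: lime_ge.
  by apply/cvg_ex; eexists; exact: lim.
by apply: nearW => n; exact: integral_step_kernel.
Qed.

End weakly_singular_operator.

(** * Cutting off the kernel *)

Section cutoff.
Context (R : realType) (T M : R) (L : R -> R -> R) (cs : seq (R * R)).
Local Notation RM := (measurableTypeR R).
Hypothesis L_bounded : bounded_by T M L.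
Hypothesis L_symmetric : symmetric_on T L.
Hypothesis L_continuous :
  {within square T `\` [set` cs], continuous (fun p => L p.1 p.2)}.
Implicit Types (t s : R) (n : nat) (p q : R * R).

Definition bump n p t s : R := Num.min 1 (n.+1%:R * (`|t - p.1| + `|s - p.2|)).

(** Each bump is paired with its reflection in the diagonal: the factor is then symmetric whatever
    [cs] is, and [L_n] inherits the symmetry of [L]. *)
Definition cutoff n t s : R := \prod_(p <- cs) (bump n p t s * bump n p s t).

Definition cut_kernel n t s : R := cutoff n t s * L t s.

(** Both coordinates occur: a bump below 1 puts [s] near the second coordinate of some [p], a
    reflected one near its first. *)
Definition centers : seq R := map fst cs ++ map snd cs.

Lemma bump_itv n p t s : 0 <= bump n p t s <= 1.
Proof. by rewrite /bump le_min ge_min lexx/= ler01 mulr_ge0// addr_ge0. Qed.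

Lemma cutoff_itv n t s : 0 <= cutoff n t s <= 1.
Proof.
apply: (big_ind (fun z => 0 <= z <= 1)); first by rewrite ler01 lexx.
  by move=> a b /andP[a0 a1] /andP[b0 b1]; rewrite mulr_ge0//= mulr_ile1.
move=> p _; have /andP[a0 a1] := bump_itv n p t s.
by have /andP[b0 b1] := bump_itv n p s t; rewrite mulr_ge0//= mulr_ile1.
Qed.

Lemma cutoff_sym n t s : cutoff n t s = cutoff n s t.
Proof. by apply: eq_bigr => p _; rewrite mulrC. Qed.

Lemma cutoff_eq0 n p : p \in cs -> cutoff n p.1 p.2 = 0.
Proof.
move=> pcs; rewrite /cutoff; apply/eqP; rewrite prodf_seq_eq0; apply/hasP.
by exists p => //=; rewrite /bump !subrr !normr0 addr0 mulr0 min_r// mul0r.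
Qed.

Lemma near_center n (c s : R) : n.+1%:R * `|s - c| < 1 ->
  \1_(`[c - n.+1%:R^-1, c + n.+1%:R^-1]) s = 1 :> R.
Proof.
rewrite mulrC -ltr_pdivlMr// mul1r ltr_norml.
move: (n.+1%:R^-1) => r /andP[h1 h2].
by rewrite indicE mem_set//= in_itv/=; apply/andP; split; lra.
Qed.

Lemma bump_lt1 n p t s : bump n p t s < 1 ->
  n.+1%:R * `|t - p.1| < 1 /\ n.+1%:R * `|s - p.2| < 1.
Proof.
rewrite /bump gt_min ltxx/= mulrDr.
have h1 : 0 <= n.+1%:R * `|t - p.1| by rewrite mulr_ge0.
have h2 : 0 <= n.+1%:R * `|s - p.2| by rewrite mulr_ge0.
by move: (n.+1%:R * _) (n.+1%:R * _) h1 h2 => a b h1 h2 h; split; lra.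
Qed.

Lemma cutoff_neq1 n t s : cutoff n t s != 1 ->
  1 <= \sum_(c <- centers) (\1_(`[c - n.+1%:R^-1, c + n.+1%:R^-1]) s : R).
Proof.
move=> ne1; have [p pcs [bp|bp]] : exists2 p, p \in cs & bump n p t s < 1 \/ bump n p s t < 1.
  apply: contrapT => H; move/eqP: ne1; apply; rewrite /cutoff big_seq big1// => p pcs.
  have e1 : bump n p t s = 1.
    apply/eqP; rewrite eq_le (andP (bump_itv n p t s)).2 leNgt/=.
    by apply/negP => h; apply: H; exists p => //; left.
  have e2 : bump n p s t = 1.
    apply/eqP; rewrite eq_le (andP (bump_itv n p s t)).2 leNgt/=.
    by apply/negP => h; apply: H; exists p => //; right.
  by rewrite e1 e2 mulr1.
- have [_ /near_center] := bump_lt1 bp.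
  have pc : p.2 \in centers by rewrite mem_cat map_f ?orbT.
  move=> e; rewrite (big_rem _ pc)/= e lerDl.
  by apply: sumr_ge0 => c _; rewrite indicE.
- have [/near_center] := bump_lt1 bp.
  have pc : p.1 \in centers by rewrite mem_cat map_f.
  move=> e _; rewrite (big_rem _ pc)/= e lerDl.
  by apply: sumr_ge0 => c _; rewrite indicE.
Qed.

Lemma cut_kernel_diff n t s : t \in `[0, T] -> s \in `[0, T] ->
  `|L t s - cut_kernel n t s| <= M /\
  (L t s - cut_kernel n t s = 0 \/
   1 <= \sum_(c <- centers) (\1_(`[c - n.+1%:R^-1, c + n.+1%:R^-1]) s : R)).
Proof.
move=> tT sT; have /andP[c0 c1] := cutoff_itv n t s.
rewrite /cut_kernel -{1 3}[L t s]mul1r -mulrBl; split.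
  rewrite normrM ger0_norm ?subr_ge0//; apply: le_trans (L_bounded tT sT).
  by rewrite ler_piMl// gerBl.
have [->|/cutoff_neq1] := eqVneq (cutoff n t s) 1; last by right.
by left; rewrite subrr mul0r.
Qed.

Lemma cut_kernel_bounded n : bounded_by T M (cut_kernel n).
Proof.
move=> t s tT sT; have /andP[c0 c1] := cutoff_itv n t s.
rewrite /cut_kernel normrM ger0_norm//; apply: le_trans (L_bounded tT sT).
by rewrite ler_piMl.
Qed.

Lemma cut_kernel_symmetric n : symmetric_on T (cut_kernel n).
Proof. by move=> t s tT sT; rewrite /cut_kernel cutoff_sym L_symmetric. Qed.

Lemma continuous_cutoff n : continuous (fun q => cutoff n q.1 q.2).
Proof.
have cl p : continuous (fun q : R * R => n.+1%:R * (`|q.1 - p.1| + `|q.2 - p.2|)).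
  move=> q; apply: cvgM; first exact: cvg_cst.
  apply: cvgD; apply: cvg_norm; apply: cvgB; try exact: cvg_cst.
    exact: cvg_fst.
  exact: cvg_snd.
have cl' p : continuous (fun q : R * R => n.+1%:R * (`|q.2 - p.1| + `|q.1 - p.2|)).
  move=> q; apply: cvgM; first exact: cvg_cst.
  apply: cvgD; apply: cvg_norm; apply: cvgB; try exact: cvg_cst.
    exact: cvg_snd.
  exact: cvg_fst.
have cb p : continuous (fun q => bump n p q.1 q.2).
  move=> q; apply: (@continuous_min _ _ (cst 1) _ q _ (cl p q)); exact: cvg_cst.
have cb' p : continuous (fun q => bump n p q.2 q.1).
  move=> q; apply: (@continuous_min _ _ (cst 1) _ q _ (cl' p q)); exact: cvg_cst.
have -> : (fun q : R * R => cutoff n q.1 q.2)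
    = (fun q => \big[*%R/1]_(p <- cs) (bump n p q.1 q.2 * bump n p q.2 q.1)) by [].
apply: continuous_big => [|p _ q]; first exact: mul_continuous.
by apply: cvgM; [exact: cb|exact: cb'].
Qed.

(** At an exceptional point the cutoff tends to 0 while [L] stays bounded by [M]; at any other point
    both factors are continuous. *)
Lemma cut_kernel_continuous n : continuous_on_square T (cut_kernel n).
Proof.
apply/subspace_continuousP => q qT.
have cq : cutoff n p.1 p.2 @[p --> within (square T) (nbhs q)] --> cutoff n q.1 q.2.
  by apply: cvg_within_filter; exact: continuous_cutoff.
change (cut_kernel n p.1 p.2 @[p --> within (square T) (nbhs q)]
  --> cut_kernel n q.1 q.2).
have [qcs|qcs] := boolP (q \in cs).
  rewrite /cut_kernel cutoff_eq0// mul0r.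
  apply: (@squeeze_cvgr _ _ _ _ (fun p => - (cutoff n p.1 p.2 * M))
    (fun p => cutoff n p.1 p.2 * M)).
  - apply: filterS (withinT _ _) => p [/= p1 p2].
    rewrite -ler_norml normrM ger0_norm ?(andP (cutoff_itv n p.1 p.2)).1//.
    by rewrite ler_wpM2l ?(andP (cutoff_itv n p.1 p.2)).1//; exact: L_bounded.
  - rewrite -oppr0; apply: cvgN; rewrite -[X in _ --> X](mul0r M).
    by apply: cvgM; [rewrite -[X in _ --> X](cutoff_eq0 n qcs)|exact: cvg_cst].
  - rewrite -[X in _ --> X](mul0r M).
    by apply: cvgM; [rewrite -[X in _ --> X](cutoff_eq0 n qcs)|exact: cvg_cst].
apply: cvgM => //.
have nq : ~ [set` cs] q by apply/negP.
have := (subspace_continuousP _ _).1 L_continuous q (conj qT nq).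
apply: cvg_trans => U tU.
have {}tU : nbhs q [set p | (square T `\` [set` cs]) p -> U (L p.1 p.2)] := tU.
have oS : nbhs q (~` [set` cs]).
  apply: open_nbhs_nbhs; split => //; apply: closed_openC.
  have haus : hausdorff_space (R * R)%type by exact: norm_hausdorff.
  apply: (accessible_finite_set_closed.1 (hausdorff_accessible haus)).
  exact: finite_seq.
have : nbhs q ([set p | (square T `\` [set` cs]) p -> U (L p.1 p.2)] `&` ~` [set` cs]).
  exact: filterI.
by apply: filterS => p [h1 h2] pT; apply: h1.
Qed.

End cutoff.

(** * The approximating equations *)

Lemma cvg_harmonic_powR (R : realType) (b : R) : 0 < b ->
  n.+1%:R^-1 `^ b @[n --> \oo] --> (0 : R).
Proof.
move=> b0; have h0 : (fun n => n.+1%:R^-1 : R) @ \oo --> 0^'+.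
  move=> U [e /= e0 eU]; 
  have : \forall n \near \oo, harmonic n < e by exact: cvgr_lt (@cvg_harmonic R) _ e0.
  apply: filterS => n ne; apply: eU => /=; last by rewrite invr_gt0.
  by rewrite sub0r normrN ger0_norm.
exact: (@cvg_comp _ _ _ (fun n => n.+1%:R^-1) (fun a : R => a `^ b) _ _ _ h0 (powR_cvg0 b0)).
Qed.

(** Pair the equation with [e], apply Cauchy-Schwarz on the right, and divide by the norm of [e]. It
    serves both uniqueness ([h = 0]) and the error estimate. *)
Lemma coercive_bound d (X : measurableType d) (R : realType)
    (mu : {measure set X -> \bar R}) (A : (X -> R) -> (X -> R)) (c : R) (e h : X -> R) :
  e \in Lfun mu 2%:E -> A e \in Lfun mu 2%:E -> h \in Lfun mu 2%:E ->
  c * dot mu e e <= dot mu e e + dot mu (A e) e ->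
  {ae mu, forall t, e t + A e t = h t} ->
  c * Num.sqrt (dot mu e e) <= Num.sqrt (dot mu h h).
Proof.
move=> le lA lh ce eAh.
have [e0|e0] := eqVneq (dot mu e e) 0.
  by rewrite e0 sqrtr0 mulr0 sqrtr_ge0.
have ep : 0 < Num.sqrt (dot mu e e) by rewrite sqrtr_gt0 lt_def e0 dot_ge0.
rewrite -(ler_pM2r ep) -mulrA -expr2 sqr_sqrtr ?dot_ge0//.
apply: le_trans ce _; rewrite -dotDl//; apply: le_trans (ler_norm _) _.
rewrite (dot_ae (f' := h) (g' := e) (Lfun2D le lA) lh le le eAh); last exact: aeW.
exact: ler_dot_sqrt.
Qed.

Section weakly_singular_equation.
Context (R : realType) (T : R) (T_gt0 : 0 < T) (nu : R).
Hypotheses (nu_gt0 : 0 < nu) (nu_lt1 : nu < 1).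
Local Notation RM := (measurableTypeR R).
Local Notation mu := (lebesgue_fin T).
Local Notation L2T := (Lfun mu 2%:E).
Local Notation k_ L := (patched T (kernel_of nu L)).
Implicit Types (t s M : R) (y z g x : R -> R) (L : R -> R -> R).

Section one_kernel.
Variables (M : R) (L : R -> R -> R).
Hypotheses (M_ge0 : 0 <= M) (L_bounded : bounded_by T M L)
  (L_symmetric : symmetric_on T L) (mL : measurable_fun setT (patched T L)).

Let mk : measurable_fun setT (k_ L) := measurable_patched_kernel nu mL.
Let ksym : forall t s : RM, k_ L (t, s) = k_ L (s, t) := @patched_kernel_sym _ _ nu _ L_symmetric.

Let schur : exists2 C, 0 <= C &
  forall t : RM, (\int[mu]_s `|k_ L (t, s)|%:E <= C%:E)%E.
Proof.
have [C C0 hC] := kernel_schur T_gt0 nu_gt0 nu_lt1.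
by exists (M * C); [exact: mulr_ge0|exact: hC].
Qed.

Lemma kernel_of_ae_integrable y : y \in L2T ->
  {ae mu, forall t, kernel_integrable T (kernel_of nu L) y t}.
Proof.
have [C C0 hC] := schur; move=> ly; have my := Lfun2_measurable ly.
apply: filterS2 (kernel_op_ae_integrable mk ksym C0 hC ly)
  (ae_lebesgue_on (fun t (tT : t \in `[0, T]) => tT)) => t it tT.
exact/(kernel_integrable_patched mk my tT).
Qed.

Lemma is_solution_patched g y : is_solution T (kernel_of nu L) g y <->
  y \in L2T /\ {ae mu, forall t, y t + kernel_op mu (k_ L) y t = g t}.
Proof.
split=> [[ly _ yg]|[ly yg]].
  split => //; move: yg; rewrite integral_op_patched//.
  exact: (Lfun2_measurable (mu := mu) ly).
split => //; first exact: kernel_of_ae_integrable.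
by rewrite integral_op_patched//; exact: (Lfun2_measurable (mu := mu) ly).
Qed.

Lemma kernel_of_self_adjoint : self_adjoint_integral_op T (kernel_of nu L).
Proof.
have [C C0 hC] := schur.
have opE y : y \in L2T -> integral_op T (kernel_of nu L) y = kernel_op mu (k_ L) y.
  by move=> ly; apply: integral_op_patched => //; exact: (Lfun2_measurable (mu := mu) ly).
have hA := kernel_op_Lfun2 mk ksym C0 hC.
split; first exact: kernel_of_ae_integrable.
split; last first.
  move=> y z ly lz; rewrite !opE//.
  exact: (kernel_op_sym mk ksym C0 hC ly lz).
split.
- by move=> y ly; rewrite opE//; exact: (hA _ ly).1.
- move=> a y z ly lz; have lyz := Lfun2_comb a 1 ly lz.
  have e : (fun r => a * y r + 1 * z r) = (fun r => a * y r + z r).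
    by apply/funext => r; rewrite mul1r.
  rewrite e in lyz; rewrite !opE//.
  have := kernel_op_comb mk ksym C0 hC a 1 ly lz; rewrite e.
  by apply: filterS => t ->; rewrite mul1r.
- exists C => y ly; rewrite opE//.
  have [lA hle] := hA _ ly.
  rewrite /L2norm (Lnorm2E lA) (Lnorm2E ly) -EFinM lee_fin.
  rewrite -(ger0_norm C0) -sqrtr_sqr -sqrtrM ?sqr_ge0//.
  exact: ler_wsqrtr.
Qed.

End one_kernel.

End weakly_singular_equation.

(** To be read with [a], [b], [c] the inner products of [A y], [A_n y] and [y] with [y]. *)
Lemma half_coercive (R : realFieldType) (a b c : R) :
  0 <= a -> a - b <= 2^-1 * c -> 2^-1 * c <= c + b.
Proof. lra. Qed.

Lemma sub_equations (R : zmodType) (a b c d e f : R) : a + b = e -> c + d = e ->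
  a - c + (b - f) = d - f.
Proof. by move=> h1 h2; rewrite addrACA h1 -h2 addrACA subrr add0r. Qed.

(** * Admissibility, operator convergence and solvability for the cut kernels *)

Section approximation.
Context (R : realType) (T nu M : R) (L : R -> R -> R) (cs : seq (R * R)).
Hypotheses (T_gt0 : 0 < T) (nu_gt0 : 0 < nu) (nu_lt1 : nu < 1).
Local Notation RM := (measurableTypeR R).
Local Notation mu := (lebesgue_fin T).
Local Notation L2T := (Lfun mu 2%:E).
Local Notation k_ L := (patched T (kernel_of nu L)).
Local Notation A_ L := (kernel_op mu (k_ L)).
Local Notation L_ := (cut_kernel L cs).
Hypotheses (L_bounded : bounded_by T M L) (L_symmetric : symmetric_on T L).
Hypothesis L_continuous :
  {within square T `\` [set` cs], continuous (fun p => L p.1 p.2)}.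
Implicit Types (t s : R) (y z g x : R -> R).

Let M_ge0 : 0 <= M.
Proof.
have T0T : 0 \in `[0, T] by rewrite in_itv/= lexx ltW.
exact: le_trans (L_bounded T0T T0T).
Qed.

Let mL : measurable_fun setT (patched T L).
Proof.
by apply: measurable_patched => //; exists [set` cs] => //; exact: finite_seq.
Qed.

Let mL_ n : measurable_fun setT (patched T (L_ n)).
Proof.
apply: measurable_patched => //; exists set0; first exact: finite_set0.
rewrite setD0; exact: (cut_kernel_continuous L_bounded L_continuous).
Qed.

Let diff n t s := L t s - L_ n t s.

Let diff_kernelE n t s :
  kernel_of nu L t s - kernel_of nu (L_ n) t s = diff n t s * `|t - s| `^ (- nu).
Proof. by rewrite /kernel_of -mulrBl powRN. Qed.

Lemma cut_kernel_admissible delta : 0 < delta -> delta < nu^-1 ->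
  admissible_approximation T nu delta M L L_.
Proof.
move=> d0 d1; pose p := nu^-1 - delta; have p0 : 0 < p by rewrite subr_gt0.
(* The power [p] turns the singularity [nu] into [a = 1 - nu * delta]; it is integrable because
   [delta > 0], and the bound decays with exponent [1 - a = nu * delta]. *)
pose a := nu * p.
have aE : 1 - a = nu * delta by rewrite /a /p; field; rewrite gt_eqF.
have b0 : 0 < nu * delta by rewrite mulr_gt0.
have a0 : 0 < a by rewrite mulr_gt0.
have a1 : a < 1 by rewrite -subr_gt0 aE.
have [C C0 hC] := singular_integral_le T a0 a1.
(* The added [n.+1%:R^-1] only makes the required inequality strict. *)
pose C1 n := M `^ p * (size (centers cs))%:R * C * n.+1%:R^-1 `^ (nu * delta)
  + n.+1%:R^-1.
have bound n t : t \in `[0, T] -> (\int[@lebesgue_measure R]_(s in `[0%R, T])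
    (`|kernel_of nu L t s - kernel_of nu (L_ n) t s| `^ p)%:E < (C1 n)%:E)%E.
  move=> tT; apply: (@le_lt_trans _ _
    (M `^ p * (size (centers cs))%:R * C * n.+1%:R^-1 `^ (nu * delta))%:E); last first.
    by rewrite lte_fin ltrDl invr_gt0.
  rewrite -aE; apply: (hC _ _ _ t) => //.
  - exact: powR_ge0.
  - apply: (@eq_measurable_fun _ _ _ _ _
      (fun s : RM => `|k_ L (t, s) - k_ (L_ n) (t, s)| `^ p)).
      by move=> s; rewrite inE/= => sT; rewrite !patchedE.
    apply: measurable_funTS; apply: (measurableT_comp (measurable_powR _)) => //.
    apply: measurableT_comp => //; apply: measurable_funB.
      by apply: (measurable_fun_pair2 (t : RM)); exact: measurable_patched_kernel.
    by apply: (measurable_fun_pair2 (t : RM)); exact: measurable_patched_kernel.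
  - move=> s sT; rewrite powR_ge0/= diff_kernelE normrM.
    rewrite [`|_ `^ _|]ger0_norm ?powR_ge0// powRM ?powR_ge0// -powRrM mulNr -/a.
    apply: ler_wpM2r; first exact: powR_ge0.
    rewrite /diff; have [DM [->|D1]] := cut_kernel_diff cs L_bounded n tT sT.
      by rewrite normr0 powR0 ?gt_eqF// mulr_ge0 ?powR_ge0// sumr_ge0.
    apply: (@le_trans _ _ (M `^ p)).
      by apply: ge0_ler_powR; rewrite ?nnegrE// ltW.
    by rewrite ler_peMr// powR_ge0.
have C10 : C1 @ \oo --> 0.
  rewrite -[X in _ --> X]addr0; apply: cvgD; last exact: cvg_harmonic.
  rewrite -[X in _ --> X](mulr0 (M `^ p * (size (centers cs))%:R * C)).
  by apply: cvgM; [exact: cvg_cst|exact: cvg_harmonic_powR].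
split=> //.
- exact: (cut_kernel_continuous L_bounded L_continuous).
- by move=> n; exact: cut_kernel_bounded.
(* Both kernels are symmetric, so the integrals in [t] and in [s] share the same bound. *)
exists C1, C1; split; [exact: C10|exact: C10| |exact: bound] => n s sT.
apply: le_lt_trans (bound n s sT); rewrite le_eqVlt; apply/orP; left; apply/eqP.
apply: eq_integral => t; rewrite inE/= => tT; rewrite /kernel_of (distrC t).
by rewrite (L_symmetric tT sT) (cut_kernel_symmetric cs L_symmetric n tT sT).
Qed.

(** [A - A_n] agrees almost everywhere with the operator of [L - L_n], whose row integrals are small
    by the local bound; Schur's test turns this into an operator norm. *)
Lemma cut_operator_close : exists2 E : nat -> R, E @ \oo --> 0 & forall n,
  0 <= E n /\ forall y, y \in L2T ->
  let D := fun t => A_ L y t - A_ (L_ n) y t in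
  [/\ A_ L y \in L2T, A_ (L_ n) y \in L2T &
      Num.sqrt (dot mu D D) <= E n * Num.sqrt (dot mu y y)].
Proof.
have [C C0 hC] := kernel_schur_local T nu_gt0 nu_lt1.
have [C' C'0 hC'] := kernel_schur T_gt0 nu_gt0 nu_lt1.
exists (fun n => M * (size (centers cs))%:R * C * n.+1%:R^-1 `^ (1 - nu)).
  rewrite -[X in _ --> X](mulr0 (M * (size (centers cs))%:R * C)).
  apply: cvgM; first exact: cvg_cst.
  by apply: cvg_harmonic_powR; rewrite subr_gt0.
move=> n; set E := _ * _; have E0 : 0 <= E by rewrite !mulr_ge0// powR_ge0.
split=> // y ly D.
have symL_ := cut_kernel_symmetric cs L_symmetric n.
have symD : symmetric_on T (diff n).
  by move=> t s tT sT; rewrite /diff L_symmetric// symL_.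
have kDE p : k_ (diff n) p = k_ L p - k_ (L_ n) p.
  rewrite !patched_kernelE -mulrBl; congr (_ * _).
  by rewrite /patched !patchE; case: ifPn => //; rewrite subrr.
have mD : measurable_fun setT (patched T (diff n)).
  rewrite (_ : patched _ _ = fun p => patched T L p - patched T (L_ n) p).
    exact: measurable_funB.
  apply/funext => p; rewrite /patched !patchE; case: ifPn => //.
  by rewrite subrr.
have DB t s : t \in `[0, T] -> s \in `[0, T] -> `|diff n t s| <=
    M * (\sum_(c <- centers cs) \1_(`[c - n.+1%:R^-1, c + n.+1%:R^-1]) s).
  move=> tT sT; have [DM [D0|D1]] := cut_kernel_diff cs L_bounded n tT sT.
    by rewrite /diff D0 normr0 mulr_ge0// sumr_ge0.
  by apply: le_trans DM _; rewrite ler_peMr.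
have r0 : 0 < n.+1%:R^-1 :> R by rewrite invr_gt0.
have kE := hC (centers cs) _ M (diff n) r0 M_ge0 mD DB.
have bM : 0 <= M * C' by rewrite mulr_ge0.
have kL := hC' _ _ M_ge0 L_bounded mL.
have kL_ := hC' _ _ M_ge0 (cut_kernel_bounded cs L_bounded n) (mL_ n).
have mk := measurable_patched_kernel nu mL.
have mk_ := measurable_patched_kernel nu (mL_ n).
have mkD := measurable_patched_kernel nu mD.
have sk := @patched_kernel_sym _ _ nu _ L_symmetric.
have sk_ := @patched_kernel_sym _ _ nu _ symL_.
have skD := @patched_kernel_sym _ _ nu _ symD.
have [lA _] := kernel_op_Lfun2 mk sk bM kL ly.
have [lA_ _] := kernel_op_Lfun2 mk_ sk_ bM kL_ ly.
have [lD leD] := kernel_op_Lfun2 mkD skD E0 kE ly.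
split=> //.
have DE : {ae mu, forall t, D t = kernel_op mu (k_ (diff n)) y t}.
  apply: filterS2 (kernel_op_ae_integrable mk sk bM kL ly)
    (kernel_op_ae_integrable mk_ sk_ bM kL_ ly) => t i1 i2.
  rewrite /D /kernel_op -RintegralB//; apply: eq_Rintegral => s _.
  by rewrite kDE; ring.
have lD' : D \in L2T by exact: Lfun2B.
rewrite (dot_ae lD' lD lD' lD DE DE) -[E](ger0_norm E0) -sqrtr_sqr.
by rewrite -sqrtrM ?sqr_ge0//; exact: ler_wsqrtr.
Qed.

Hypothesis L_posdef : positive_definite T L.

Lemma cut_equation_solvable g x : g \in L2T ->
  is_solution T (kernel_of nu L) g x -> exists x_ : nat -> R -> R,
    (\forall n \near \oo, is_unique_solution T (kernel_of nu (L_ n)) g (x_ n)) /\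
    (fun n => L2norm T (fun t => x_ n t - x t)) @ \oo --> (0 : \bar R)%E.
Proof.
move=> lg xsol; have [E E0 hE] := cut_operator_close.
have [C C_ge0 hC] := kernel_schur T_gt0 nu_gt0 nu_lt1.
have Lc : continuous_except_finite T L by exists [set` cs] => //; exact: finite_seq.
have bM : 0 <= M * C by rewrite mulr_ge0.
have [lx xg] := (is_solution_patched T_gt0 nu_gt0 nu_lt1 M_ge0 L_bounded
  L_symmetric mL g x).1 xsol.
(* The threshold sits under the existential so that choice yields a sequence defined for every [n];
   where [E n] is too large an arbitrary function is taken. *)
have step n : exists z, E n <= 2^-1 ->
    is_unique_solution T (kernel_of nu (L_ n)) g z /\
    (L2norm T (fun t => (z t - x t)%R)
      <= (2 * E n * Num.sqrt (dot mu x x))%:E)%E.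
  have [En|_] := boolP (E n <= 2^-1); last by exists (cst 0).
  have bL_ := cut_kernel_bounded cs L_bounded n.
  have symL_ := cut_kernel_symmetric cs L_symmetric n.
  have kL_ := hC _ _ M_ge0 bL_ (mL_ n).
  have mk_ := measurable_patched_kernel nu (mL_ n).
  have sk_ := @patched_kernel_sym _ _ nu _ symL_.
  have solE := is_solution_patched T_gt0 nu_gt0 nu_lt1 M_ge0 bL_ symL_ (mL_ n) g.
  have lA y (ly : y \in L2T) := (kernel_op_Lfun2 mk_ sk_ bM kL_ ly).1.
  have hlin := kernel_op_comb mk_ sk_ bM kL_.
  have coer y : y \in L2T ->
      2^-1 * dot mu y y <= dot mu y y + dot mu (A_ (L_ n) y) y.
    move=> ly; have [En0 /(_ _ ly)[lAy lAny Dle]] := hE n.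
    have Apos := kernel_op_ge0 T_gt0 nu_gt0 nu_lt1 L_bounded L_symmetric Lc L_posdef ly.
    have := ler_dot_sqrt (Lfun2B lAy lAny) ly; rewrite dotBl// => h1.
    have h2 := le_trans (ler_norm _) h1.
    have h3 : Num.sqrt (dot mu (fun t => A_ L y t - A_ (L_ n) y t)
        (fun t => A_ L y t - A_ (L_ n) y t)) * Num.sqrt (dot mu y y)
        <= 2^-1 * dot mu y y.
      rewrite -[in leRHS](sqr_sqrtr (dot_ge0 mu y)) expr2 mulrA.
      rewrite ler_wpM2r ?sqrtr_ge0//; apply: le_trans Dle _.
      by rewrite ler_wpM2r ?sqrtr_ge0.
    exact: half_coercive Apos (le_trans h2 h3).
  have half0 : 0 < 2^-1 :> R by rewrite invr_gt0.
  have [z lz zg] := @coercive_solvable _ RM R mu (A_ (L_ n)) 2^-1 (M * C) g lA hlin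
    (fun y ly => (kernel_op_Lfun2 mk_ sk_ bM kL_ ly).2) half0 coer lg.
  exists z => _.
  have linB y w : y \in L2T -> w \in L2T -> {ae mu, forall t,
      A_ (L_ n) (fun r => y r - w r) t = A_ (L_ n) y t - A_ (L_ n) w t}.
    move=> ly lw; have := hlin 1 (-1) _ _ ly lw.
    rewrite (_ : (fun r => 1 * y r + -1 * w r) = (fun r => y r - w r)).
      by apply: filterS => t ->; ring.
    by apply/funext => r; ring.
  split; first split; first exact/solE.
    move=> y /solE[ly yg]; have le := Lfun2B ly lz.
    have l0 : (fun=> 0) \in L2T by have := Lfun2Z 0 ly; under eq_fun do rewrite mul0r.
    (* The difference of two solutions solves the homogeneous equation. *)
    have := coercive_bound le (lA _ le) l0 (coer _ le).
    have -> : dot mu (fun=> 0) (fun=> 0) = 0.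
      by have := dotZl 0 ly l0; under eq_fun do rewrite mul0r; rewrite mul0r.
    rewrite sqrtr0 => cb; have {}cb : dot mu (fun t => y t - z t) (fun t => y t - z t) = 0.
      apply/eqP; rewrite eq_le dot_ge0 andbT -sqrtr_eq0 eq_le sqrtr_ge0 andbT.
      rewrite -(ler_pM2l half0) mulr0; apply: cb.
      apply: (@filterS3 _ _ (ae_filter_ringOfSetsType (lebesgue_fin T)) _ _ _ _ _
        (linB _ _ ly lz) yg zg) => t -> h1 h2.
      by rewrite (sub_equations _ h1 h2) subrr.
    by apply: filterS (dot_eq0 le cb) => t /eqP; rewrite subr_eq0 => /eqP.
  have [_ /(_ _ lx)[lAx lAnx Dle]] := hE n.
  have le := Lfun2B lz lx; have lD := Lfun2B lAx lAnx.
  rewrite /L2norm (Lnorm2E (mu := mu) le) lee_fin.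
  (* Subtracting the two equations, the error [e = z - x] satisfies [e + A_n e = A x - A_n x], with
     [A_n] acting on the error and the operator difference on the fixed [x]. *)
  have := coercive_bound le (lA _ le) lD (coer _ le) => cb.
  have {}cb : 2^-1 * Num.sqrt (dot mu (fun t => z t - x t) (fun t => z t - x t))
      <= E n * Num.sqrt (dot mu x x).
    apply: le_trans (cb _) Dle.
    apply: (@filterS3 _ _ (ae_filter_ringOfSetsType (lebesgue_fin T)) _ _ _ _ _
      (linB _ _ lz lx) zg xg) => t -> h1 h2.
    exact: sub_equations h1 h2.
  by rewrite -mulrA -ler_pdivrMl.
have [x_ hx] := choice step.
exists x_; split.
  by apply: filterS (cvgr_le _ E0 _ (_ : 0 < 2^-1)) => [n /hx[]//|]; rewrite invr_gt0.
apply: (@squeeze_cvge _ _ _ _ (fun=> 0%E) _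
  (fun n => (2 * E n * Num.sqrt (dot mu x x))%:E)).
- have : \forall n \near \oo, E n <= 2^-1.
    by apply: cvgr_le E0 _ _; rewrite invr_gt0.
  by apply: filterS => n /hx[_ ->]; rewrite Lnorm_ge0.
- exact: cvg_cst.
- apply: cvg_EFin; first exact: nearW.
  rewrite -[X in _ --> X](mul0r (Num.sqrt (dot mu x x))).
  apply: cvgM; last exact: cvg_cst.
  by rewrite -[X in _ --> X](mulr0 2); apply: cvgM => //; exact: cvg_cst.
Qed.

End approximation.

Theorem theorem3p6 (R : realType) (T nu delta M : R)
    (L : R -> R -> R) (g x : R -> R)
    (T_gt0 : 0 < T) (nu_gt0 : 0 < nu) (nu_lt1 : nu < 1)
    (gL2 : g \in L2 T)
    (L_bounded : bounded_by T M L)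
    (L_symmetric : symmetric_on T L)
    (L_continuous : continuous_except_finite T L)
    (L_posdef : positive_definite T L)
    (x_solution : is_unique_solution T (kernel_of nu L) g x)
    (delta_gt0 : 0 < delta) (delta_lt : delta < nu^-1) :
  exists L_ : nat -> R -> R -> R,
    [/\ admissible_approximation T nu delta M L L_,
        forall n, self_adjoint_integral_op T (kernel_of nu (L_ n)) &
        exists x_ : nat -> R -> R,
          (\forall n \near \oo,
             is_unique_solution T (kernel_of nu (L_ n)) g (x_ n)) /\
          (fun n => L2norm T (fun t => x_ n t - x t)) @ \oo --> (0 : \bar R)%E].
Proof.
have [S fS cL] := L_continuous; have [cs Scs] := (finite_seqP S).1 fS.
rewrite Scs in cL.
have T0T : 0 \in `[0, T] by rewrite in_itv/= lexx ltW.
have M0 : 0 <= M := le_trans (normr_ge0 _) (L_bounded _ _ T0T T0T).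
have bL_ := cut_kernel_bounded cs L_bounded.
have symL_ := cut_kernel_symmetric cs L_symmetric.
have cL_ := cut_kernel_continuous L_bounded cL.
exists (cut_kernel L cs); split.
- exact: cut_kernel_admissible.
- move=> n; apply: (kernel_of_self_adjoint T_gt0 nu_gt0 nu_lt1 M0 (bL_ n) (symL_ n)).
  apply: measurable_patched => //; exists set0; first exact: finite_set0.
  by rewrite setD0; exact: cL_.
- exact: (cut_equation_solvable T_gt0 nu_gt0 nu_lt1 L_bounded L_symmetric cL
    L_posdef gL2 x_solution.1).
Qed.
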